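(* Let $\mathcal{A}$ be a unital C$^*$-algebra with unitary group $\mathcal{U}$, $\mathcal{K}\subset\mathcal{A}^2$ its unitary sphere and $\mathcal{R}\subset M_2(\mathcal{A})$ its Riemann sphere. The Hopf fibration $\mathfrak{h}:\mathcal{K}\to\mathcal{R}$, $\mathfrak{h}(\mathbf{x})=\mathbf{x}\mathbf{x}^*$, is a $C^\infty$ principal bundle with structure group $\mathcal{U}$, where $\mathcal{U}$ acts on $\mathcal{K}$ on the right by $\mathbf{x}u=\begin{pmatrix} x_1u \\ x_2u \end{pmatrix}$.
   Context: $\mathcal{A}^2$ is the right $\mathcal{A}$-module of columns $\mathbf{x}=\begin{pmatrix} x_1 \\ x_2 \end{pmatrix}$ with $x_1,x_2\in\mathcal{A}$; $\mathbf{x}^*=\begin{pmatrix} x_1^* & x_2^* \end{pmatrix}$. $\mathcal{U}_2$ is the unitary group of $M_2(\mathcal{A})$, $\mathbf{e}_1=\begin{pmatrix} 1 \\ 0 \end{pmatrix}$, $\tilde p_0=\begin{pmatrix} 1 & 0 \\ 0 & 0 \end{pmatrix}$, $\mathcal{K}=\{\tilde u\mathbf{e}_1:\tilde u\in\mathcal{U}_2\}$, $\mathcal{R}=\{\tilde u\tilde p_0\tilde u^*:\tilde u\in\mathcal{U}_2\}$. Smooth structure of $\mathcal{K}$: let $\mathcal{K}_0=\{\mathbf{x}\in\mathcal{K}:x_1\text{ invertible}\}$ and $\psi_0:\mathcal{K}_0\to\mathcal{A}\times\mathcal{U}$, $\psi_0(\mathbf{x})=(x_2x_1^{-1},u)$,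 where $x_1=ru$ is the polar decomposition with $r$ positive and $u$ unitary; its inverse is $(a,u)\mapsto\begin{pmatrix} (1+a^*a)^{-1/2}u \\ a(1+a^*a)^{-1/2}u \end{pmatrix}$. The atlas consists of the charts $(\tilde u\mathcal{K}_0,\ \psi_0\circ\tilde u^{-1},\ \mathcal{A}\times\mathcal{U})$, $\tilde u\in\mathcal{U}_2$. Smooth structure of $\mathcal{R}$: let $\mathcal{V}_0=\mathfrak{h}(\mathcal{K}_0)$ and $\varphi_0:\mathcal{V}_0\to\mathcal{A}$, $\varphi_0(\mathbf{x}\mathbf{x}^* )=x_2x_1^{-1}$ for $\mathbf{x}\in\mathcal{K}_0$ (well defined and bijective). The atlas consists of the charts $(\tilde u\mathcal{V}_0\tilde u^{-1},\ \varphi_0\circ L_{\tilde u^{-1}},\ \mathcal{A})$, $\tilde u\in\mathcal{U}_2$, where $L_{\tilde u}(\tilde p)=\tilde u\tilde p\tilde u^{-1}$. Being a $C^\infty$ principal bundle means: $\mathfrak{h}$ is a $C^\infty$ map onto $\mathcal{R}$, the fibers of $\mathfrak{h}$ are the orbits of the (free, smooth) right action of the Banach-Lie group $\mathcal{U}$ on $\mathcal{K}$, and $\mathfrak{h}$ has $C^\infty$ local cross sections. *)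

(* Defs.v *)
From HB Require Import structures.
From mathcomp Require Import all_boot all_order all_algebra.
From mathcomp Require Import complex.
From mathcomp Require Import all_classical all_reals all_analysis.

Set Implicit Arguments.
Unset Strict Implicit.
Unset Printing Implicit Defensive.

Import Order.TTheory GRing.Theory Num.Theory.
Import numFieldNormedType.Exports.

Local Open Scope classical_set_scope.
Local Open Scope complex_scope.
Local Open Scope ring_scope.

(* The zero algebra is allowed.  The multiplication is a field of the mixin
   because HB refuses the join of the existing ring and normed-module classes;
   the ring structure is recovered just below. *)

HB.mixin Record isCStarAlgebra (R : realType) (A : Type)
    of CompleteNormedModule R[i] A := {
  cmul : A -> A -> A;
  cone : A;
  cmulA : associative cmul;
  cmul1l : left_id cone cmul;
  cmul1r : right_id cone cmul;
  cmulDl : left_distributive cmul +%R;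
  cmulDr : right_distributive cmul +%R;
  cscalerAl : forall (k : R[i]) x y, k *: cmul x y = cmul (k *: x) y;
  cscalerAr : forall (k : R[i]) x y, k *: cmul x y = cmul x (k *: y);
  star : A -> A;
  starD : {morph star : x y / x + y};
  starZ : forall (k : R[i]) x, star (k *: x) = k^* *: star x;
  starM : forall x y, star (cmul x y) = cmul (star y) (star x);
  starK : involutive star;
  ler_normM : forall x y, `|cmul x y| <= `|x| * `|y|;
  cstar_identity : forall x, `|cmul (star x) x| = `|x| ^+ 2
}.

#[short(type="cstarAlgType")]
HB.structure Definition CStarAlgebra (R : realType) :=
  { A of CompleteNormedModule R[i] A & isCStarAlgebra R A }.

HB.instance Definition _ (R : realType) (A : cstarAlgType R) :=
  GRing.Zmodule_isPzRing.Build A (@cmulA R A) (@cmul1l R A) (@cmul1r R A)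
    (@cmulDl R A) (@cmulDr R A).

(* A as a real normed space: smoothness is real smoothness, as the charts
   below involve the involution. *)

Section Realification.
Context (R : realType).

Definition realify (A : cstarAlgType R) : Type := A.

Variable A : cstarAlgType R.

HB.instance Definition _ := GRing.Zmodule.on (realify A).

Let rscale (t : R) (x : realify A) : realify A := t%:C *: (x : A).

Let rscaleA a b x : rscale a (rscale b x) = rscale (a * b) x.
Proof. by rewrite /rscale scalerA rmorphM. Qed.
Let rscale1 : left_id 1 rscale.
Proof. by move=> x; rewrite /rscale scale1r. Qed.
Let rscaleDr : right_distributive rscale +%R.
Proof. by move=> a x y; rewrite /rscale scalerDr. Qed.
Let rscaleDl x : {morph rscale^~ x : a b / a + b}.
Proof. by move=> a b; rewrite /rscale rmorphD scalerDl. Qed.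

HB.instance Definition _ := GRing.Zmodule_isLmodule.Build R (realify A)
  rscaleA rscale1 rscaleDr rscaleDl.

Let rnorm (x : realify A) : R := complex.Re `|x : A|.

Let rnormE x : (rnorm x)%:C = `|x : A|.
Proof. by rewrite /rnorm RRe_real // normr_real. Qed.

Let rnormD x y : rnorm (x + y) <= rnorm x + rnorm y.
Proof. by rewrite -lecR rmorphD /= !rnormE ler_normD. Qed.
Let rnormZ (l : R) x : rnorm (l *: x) = `|l| * rnorm x.
Proof.
apply: (@complexI R); rewrite rmorphM /= !rnormE normrZ; congr (_ * _).
by rewrite normc_def /= expr0n addr0 sqrtr_sqr.
Qed.
Let rnorm0_eq0 x : rnorm x = 0 -> x = 0.
Proof. by move=> x0; apply: normr0_eq0; rewrite -rnormE x0. Qed.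

HB.instance Definition _ := Lmodule_isNormed.Build R (realify A)
  rnormD rnormZ rnorm0_eq0.

End Realification.

Section ContinuousLinear.
Context (R : realType) (E F : normedModType R).

Definition clin : {pred E -> F} := fun f => `[< linear f /\ continuous f >].

Let clin_submod_closed : submod_closed clin.
Proof.
split=> [|k f g]; rewrite ?inE.
  by split; [move=> k x y /=; rewrite scaler0 addr0|exact: cst_continuous].
move=> [lf cf] [lg cg]; split=> [a x y|x].
  rewrite [LHS]/(k *: f (a *: x + y) + g (a *: x + y)).
  rewrite [X in _ = _ *: X + _]/(k *: f x + g x).
  rewrite [X in _ = _ + X]/(k *: f y + g y).
  by rewrite lf lg !scalerDr !scalerA mulrC addrACA.
by apply: cvgD; [apply: cvgZr; exact: cf|exact: cg].
Qed.

HB.instance Definition _ := GRing.isSubmodClosed.Build R (E -> F) clin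
  clin_submod_closed.

Record clinear := CLinear { clinear_fun :> E -> F; _ : clin clinear_fun }.

HB.instance Definition _ := [isSub for clinear_fun].
HB.instance Definition _ := [Choice of clinear by <:].
HB.instance Definition _ := [SubChoice_isSubZmodule of clinear by <:].
HB.instance Definition _ := [SubZmodule_isSubLmodule of clinear by <:].

Definition opnorm (f : clinear) : R :=
  sup [set `|f x| | x in [set x : E | `|x| <= 1]].

Lemma clinearP (f : clinear) : linear f /\ continuous f.
Proof. by case: f => f /= /asboolP. Qed.

Lemma opnorm_has_sup (f : clinear) :
  has_sup [set `|f x| | x in [set x : E | `|x| <= 1]].
Proof.
have [lf cf] := clinearP f; pose g : {linear E -> F} :=
  HB.pack (f : E -> F) (GRing.isLinear.Build _ _ _ _ (f : E -> F) lf).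
split; first by exists `|f 0|, 0 => //=; rewrite normr0.
have /linear_boundedP/pinfty_ex_gt0[M M0 Mf] : bounded_near g (nbhs 0).
  exact/linear_bounded_continuous.
by exists M => _ [x /= x1 <-]; apply: (le_trans (Mf x)); rewrite ger_pMr.
Qed.

Lemma le_opnorm (f : clinear) x : `|f x| <= opnorm f * `|x|.
Proof.
have [lf cf] := clinearP f; pose g : {linear E -> F} :=
  HB.pack (f : E -> F) (GRing.isLinear.Build _ _ _ _ (f : E -> F) lf).
have [->|x0] := eqVneq x 0.
  by rewrite (_ : f 0 = 0) ?normr0 ?mulr0//; exact: (linear0 g).
have nx0 : 0 < `|x| by rewrite normr_gt0.
rewrite -ler_pdivrMr// mulrC -[X in X * _]ger0_norm ?invr_ge0// -normrZ.
rewrite (_ : _ *: f x = f (`|x|^-1 *: x)); last by rewrite [RHS](linearZ_LR g).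
apply: sup_upper_bound; first exact: opnorm_has_sup.
exists (`|x|^-1 *: x) => //=.
by rewrite normrZ ger0_norm ?invr_ge0// mulVf ?gt_eqF.
Qed.

Lemma opnorm_le (f : clinear) (M : R) : 0 <= M ->
  (forall x, `|f x| <= M * `|x|) -> opnorm f <= M.
Proof.
move=> M0 fM; apply: ge_sup; first exact: (opnorm_has_sup f).1.
by move=> _ [x /= x1 <-]; apply: (le_trans (fM x)); rewrite ler_piMr.
Qed.

Lemma opnorm_ge0 (f : clinear) : 0 <= opnorm f.
Proof.
apply: (le_trans (normr_ge0 (f 0))); apply: sup_upper_bound.
  exact: opnorm_has_sup.
by exists 0 => //=; rewrite normr0.
Qed.

Let opnormD f g : opnorm (f + g) <= opnorm f + opnorm g.
Proof.
apply: opnorm_le => [|x]; first by rewrite addr_ge0 ?opnorm_ge0.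
by rewrite mulrDl (le_trans (ler_normD _ _))// lerD ?le_opnorm.
Qed.

Let opnormZ (l : R) f : opnorm (l *: f) = `|l| * opnorm f.
Proof.
have le l' g : opnorm (l' *: g) <= `|l'| * opnorm g.
  apply: opnorm_le => [|x]; first by rewrite mulr_ge0 ?opnorm_ge0.
  by rewrite [X in `|X|](_ : _ = l' *: g x)// normrZ -mulrA ler_wpM2l ?le_opnorm.
have [->|l0] := eqVneq l 0.
  apply/eqP; rewrite eq_le le normr0 mul0r opnorm_ge0//.
apply/eqP; rewrite eq_le le/= -ler_pdivlMl ?normr_gt0// -normfV.
by rewrite -{1}[f]scale1r -(mulVf l0) -scalerA le.
Qed.

Let opnorm0_eq0 f : opnorm f = 0 -> f = 0.
Proof.
move=> f0; apply: val_inj; apply/funext => x.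
change (f x = 0); apply/eqP.
by rewrite -normr_le0 (le_trans (le_opnorm f x))// f0 mul0r.
Qed.

HB.instance Definition _ := Lmodule_isNormed.Build R clinear
  opnormD opnormZ opnorm0_eq0.

End ContinuousLinear.

(* 'd f x as a continuous linear map; it is one whenever f is differentiable
   at x, so the default value 0 plays no role below. *)
Definition frechet (R : realType) (E F : normedModType R) (f : E -> F) (x : E) :
  clinear E F := insubd 0 ('d f x : E -> F).

Lemma frechetE (R : realType) (E F : normedModType R) (f : E -> F) (x : E) :
  differentiable f x -> frechet f x = 'd f x :> (E -> F).
Proof.
move=> df; rewrite /frechet; apply: (@insubdK (E -> F)).
by rewrite unfold_in; apply/asboolP; split;
  [exact: linearP|exact: diff_continuous].
Qed.

Fixpoint Ck (k : nat) (R : realType) (E F : normedModType R) (U : set E)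
    (f : E -> F) : Prop :=
  if k is k'.+1 then
    (forall x, U x -> differentiable f x) /\ Ck k' U (frechet f)
  else forall x, U x -> {for x, continuous f}.

Definition smooth_on (R : realType) (E F : normedModType R) (U : set E)
    (f : E -> F) := open U /\ forall k, Ck k U f.

Record chart (R : realType) (T : Type) (E : normedModType R) :=
  Chart { dom : set T; coord : T -> E }.

(* The points of a manifold form a subset of an ambient type. *)
Record manifold (R : realType) (T : Type) (E : normedModType R) :=
  Manifold { points : set T; atlas : set (chart T E) }.

Section Manifolds.
Context (R : realType).

Section Maps.
Context (T T' : Type) (E E' : normedModType R).

(* d \o f \o c^-1 is smooth on the open set c(P).  For c injective on P,
   [g] below is the map d \o f \o c^-1 on c(P). *)
Definition smooth_in_charts (c : chart T E) (d : chart T' E') (P : set T)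
    (f : T -> T') :=
  exists2 g : E -> E', smooth_on (coord c @` P) g &
    forall p, P p -> g (coord c p) = coord d (f p).

Definition smooth_map (M : manifold T E) (N : manifold T' E') (W : set T)
    (f : T -> T') : Prop :=
  (forall p, W p -> points N (f p)) /\
  forall c d, atlas M c -> atlas N d ->
    smooth_in_charts c d (W `&` dom c `&` f @^-1` dom d) f.

End Maps.

Definition is_manifold (T : Type) (E : normedModType R) (M : manifold T E) :=
  [/\ points M = \bigcup_(c in atlas M) dom c,
      forall c, atlas M c -> {in dom c &, injective (coord c)} &
      forall c d, atlas M c -> atlas M d ->
        smooth_in_charts c d (dom c `&` dom d) id].

Definition open_in (T : Type) (E : normedModType R) (M : manifold T E)
    (W : set T) :=
  W `<=` points M /\
  forall c, atlas M c -> open (coord c @` (W `&` dom c)).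

Definition normed_manifold (T : Type) (E : normedModType R) (coordE : T -> E) :
    manifold T E :=
  Manifold setT [set Chart setT coordE].

Definition prod_manifold (T T' : Type) (E E' : normedModType R)
    (M : manifold T E) (N : manifold T' E') :
    manifold (T * T') (E * E')%type :=
  Manifold (points M `*` points N)
    [set Chart (dom cd.1 `*` dom cd.2)
               (fun p => (coord cd.1 p.1, coord cd.2 p.2))
       | cd in atlas M `*` atlas N].

(* The manifold given by an atlas of charts (D, psi, N), where each psi takes
   its values in a manifold N. *)
Definition charted_manifold (T T' : Type) (E : normedModType R) (M : set T)
    (C : set (set T * (T -> T'))) (N : manifold T' E) : manifold T E :=
  Manifold M
    [set Chart (cd.1.1 `&` cd.1.2 @^-1` dom cd.2) (coord cd.2 \o cd.1.2)
       | cd in C `*` atlas N].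

Section LieGroups.
Context (T : Type) (E : normedModType R) (G : manifold T E).
Variables (mul : T -> T -> T) (one : T) (inv : T -> T).

Definition is_lie_group :=
  [/\ is_manifold G,
      [/\ points G one,
          forall g h, points G g -> points G h -> points G (mul g h) &
          forall g, points G g -> points G (inv g)],
      [/\ forall g h k, points G g -> points G h -> points G k ->
            mul g (mul h k) = mul (mul g h) k,
          forall g, points G g -> mul one g = g /\ mul g one = g &
          forall g, points G g -> mul (inv g) g = one /\ mul g (inv g) = one],
      smooth_map (prod_manifold G G) G (points G `*` points G)
        (fun gh => mul gh.1 gh.2) &
      smooth_map G G (points G) inv].

Context (TP TB : Type) (EP EB : normedModType R).
Variables (P : manifold TP EP) (B : manifold TB EB).
Variables (act : TP -> T -> TP) (pr : TP -> TB).

Definition is_free_smooth_right_action :=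
  [/\ smooth_map (prod_manifold P G) P (points P `*` points G)
        (fun pg => act pg.1 pg.2),
      forall p, points P p -> act p one = p,
      forall p g h, points P p -> points G g -> points G h ->
        act (act p g) h = act p (mul g h) &
      forall p g, points P p -> points G g -> act p g = p -> g = one].

Definition is_smooth_principal_bundle :=
  [/\ is_manifold P /\ is_manifold B,
      is_lie_group /\ is_free_smooth_right_action,
      smooth_map P B (points P) pr /\ pr @` points P = points B,
      forall p q, points P p -> points P q ->
        (pr p = pr q <-> exists2 g, points G g & q = act p g) &
      forall b, points B b -> exists W (s : TB -> TP),
        [/\ open_in B W, W b, smooth_map B P W s &
            forall x, W x -> pr (s x) = x]].

End LieGroups.
End Manifolds.

Section Elements.
Context (R : realType) (A : cstarAlgType R).
Implicit Types x y u : A.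

Definition is_inverse x y := x * y = 1 /\ y * x = 1.
Definition invertible x := exists y, is_inverse x y.
Definition inverse x : A := xget 0 [set y | is_inverse x y].

Definition spectrum x : set R[i] := [set l | ~ invertible (x - l *: (1 : A))].

(* On R[i], 0 <= l means that l is a nonnegative real. *)
Definition positive x := star x = x /\ forall l, spectrum x l -> 0 <= l.

Definition unitary u := star u * u = 1 /\ u * star u = 1.

Definition polar_unitary x : A :=
  xget 1 [set u | unitary u /\ exists r, positive r /\ x = r * u].

Definition adj (m n : nat) (X : 'M[A]_(m, n)) : 'M[A]_(n, m) :=
  (map_mx star X)^T.

Definition unitary_mx (U : 'M[A]_2) :=
  adj U *m U = 1%:M /\ U *m adj U = 1%:M.

End Elements.

Section UnitaryGroup.
Context (R : realType) (A : cstarAlgType R).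

Definition skew : {pred realify A} := fun x : A => star x == - x.

Lemma starN (x : A) : star (- x) = - star x.
Proof. by rewrite -scaleN1r starZ rmorphN1 scaleN1r. Qed.

Let skew_submod_closed : submod_closed skew.
Proof.
split=> [|k x y]; rewrite !unfold_in.
  by rewrite -[X in star X](scale0r 0) starZ rmorph0 scale0r oppr0.
move=> /eqP sx /eqP sy; apply/eqP.
rewrite [LHS](@starD R A) [X in X + _](@starZ R A) sx sy.
by rewrite [_^*]conjc_real scalerN opprD.
Qed.

HB.instance Definition _ := GRing.isSubmodClosed.Build R (realify A) skew
  skew_submod_closed.

Record skew_adjoint := SkewAdjoint { skew_val :> realify A; _ : skew skew_val }.

HB.instance Definition _ := [isSub for skew_val].
HB.instance Definition _ := [Choice of skew_adjoint by <:].
HB.instance Definition _ := [SubChoice_isSubZmodule of skew_adjoint by <:].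
HB.instance Definition _ := [SubZmodule_isSubLmodule of skew_adjoint by <:].

Let snorm (x : skew_adjoint) : R := `|val x|.

Let snormD x y : snorm (x + y) <= snorm x + snorm y.
Proof. exact: ler_normD. Qed.
Let snormZ (l : R) x : snorm (l *: x) = `|l| * snorm x.
Proof. exact: normrZ. Qed.
Let snorm0_eq0 x : snorm x = 0 -> x = 0.
Proof. by move=> /normr0_eq0 x0; apply: val_inj. Qed.

HB.instance Definition _ := Lmodule_isNormed.Build R skew_adjoint
  snormD snormZ snorm0_eq0.

(* The Lie group structure of the unitary group, given by Cayley charts:
   around v, w |-> (1 - z) (1 + z)^-1 with z = v^* w.  They map onto the
   skew-adjoint elements, so the default 0 of insubd is not used, and they make
   the unitary group a submanifold of A. *)
Definition cayley_chart (v : A) : chart A skew_adjoint :=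
  Chart [set w | unitary w /\ invertible (1 + star v * w)]
    (fun w => insubd (0 : skew_adjoint)
       ((1 - star v * w) * inverse (1 + star v * w) : A)).

Definition unitary_group : manifold A skew_adjoint :=
  Manifold (@unitary R A) [set cayley_chart v | v in @unitary R A].

End UnitaryGroup.

Section Hopf.
Context (R : realType) (A : cstarAlgType R).

Definition e1 : 'cV[A]_2 := delta_mx 0 0.
Definition p0 : 'M[A]_2 := delta_mx 0 0.

Definition sphere : set 'cV[A]_2 := [set U *m e1 | U in @unitary_mx R A].
Definition projections : set 'M[A]_2 :=
  [set U *m p0 *m adj U | U in @unitary_mx R A].

Definition hopf (x : 'cV[A]_2) : 'M[A]_2 := x *m adj x.

Definition right_mul (x : 'cV[A]_2) (u : A) : 'cV[A]_2 := \col_i (x i 0 * u).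

Definition sphere0 : set 'cV[A]_2 :=
  sphere `&` [set x | invertible (x 0 0)].

Definition psi0 (x : 'cV[A]_2) : A * A :=
  (x 1 0 * inverse (x 0 0), polar_unitary (x 0 0)).

Definition alg_manifold : manifold A (realify A) :=
  normed_manifold (fun a : A => a : realify A).

(* The inverse of a unitary matrix U is written adj U. *)
Definition unitary_sphere :
    manifold 'cV[A]_2 (realify A * skew_adjoint A)%type :=
  charted_manifold sphere
    [set ((mulmx U) @` sphere0, psi0 \o mulmx (adj U))
       | U in @unitary_mx R A]
    (prod_manifold alg_manifold (unitary_group A)).

Definition projections0 : set 'M[A]_2 := hopf @` sphere0.

Definition phi0 (p : 'M[A]_2) : A :=
  let x := xget 0 [set x | sphere0 x /\ hopf x = p] in
  x 1 0 * inverse (x 0 0).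

Definition conj_mx (U p : 'M[A]_2) : 'M[A]_2 := U *m p *m adj U.

Definition riemann_sphere : manifold 'M[A]_2 (realify A) :=
  charted_manifold projections
    [set (conj_mx U @` projections0, phi0 \o conj_mx (adj U))
       | U in @unitary_mx R A]
    alg_manifold.

End Hopf.

(* Main.v *)
(* Everything rests on square roots in a Banach algebra.  Call [a] "ppos" when
   [|t - a| < t] for some real [t].  If [c] and [d] are ppos, the Sylvester
   operator [h |-> c h + h d] is a bounded bijection, by a contraction
   argument; hence square roots in the ppos cone exist, are unique, and inherit
   self-adjointness and commutation relations.  This gives the polar
   decomposition of invertible elements without any spectral theory, and for
   invertible self-adjoint elements ppos agrees with positivity of the
   spectrum.  Inverses and square roots are smooth by bootstrapping, since
   their difference quotients are smooth functions of the values of the map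
   itself.

   The unitary group, the sphere and the Riemann sphere all sit in normed
   spaces in such a way that charts and inverse charts are restrictions of
   smooth maps of the ambient spaces, so every smoothness statement reduces to
   that of an explicit ambient formula.  The local sections of the Hopf map are
   the translates of [x x^* |-> (rho, a rho)], where [a = x_2 x_1^-1] and
   [rho = (1 + a^* a)^(-1/2)]. *)

Require Import Defs.
From HB Require Import structures.
From mathcomp Require Import all_boot all_order all_algebra.
From mathcomp Require Import complex.
From mathcomp Require Import all_classical all_reals all_analysis.
From mathcomp Require Import ring lra.

Set Implicit Arguments.
Unset Strict Implicit.
Unset Printing Implicit Defensive.

Import Order.TTheory GRing.Theory Num.Theory.
Import numFieldNormedType.Exports.

Local Open Scope classical_set_scope.
Local Open Scope complex_scope.
Local Open Scope ring_scope.

Local Notation coord := Defs.coord.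

(** * Bounded linear maps and Frechet derivatives *)

(** The definitions speak of spectra and of a chosen [polar_unitary], while smoothness asks for maps
    on open subsets of a real normed space. Self-adjoint elements do not form an open set in
    general, so a functional calculus on them would have to be extended before it could be
    differentiated. The condition [|t - a| < t] asks for no self-adjointness: over all [t] it
    describes a union of open balls, an open convex cone, so differentiating the square root there
    makes sense. For self-adjoint [a] it says that the spectrum lies strictly between [0] and [2 t],
    hence the link with spectral positivity. The other obstacle is that a positivity theory has to
    be built without the spectral theorem. The order is replaced by norm estimates drawn from the
    C*-identity, through normal elements [a + i b], and by continuity arguments along the resolvent.
    Inverses need care as well, because a one-sided inverse in [A] need not be two-sided; several
    arguments therefore produce a left and a right inverse separately. *)

HB.instance Definition _ (R : realType) (E F : normedModType R)
    (f : clinear E F) :=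
  GRing.isLinear.Build R E F _ (clinear_fun f) (clinearP f).1.

Section BoundedLinear.
Context (R : realType) (E F : normedModType R).

Lemma bounded_clin (f : E -> F) (M : R) : linear f ->
  (forall x, `|f x| <= M * `|x|) -> clin f.
Proof.
move=> lf fM; apply/asboolP; split=> // x.
pose g : {linear E -> F} := HB.pack f (GRing.isLinear.Build _ _ _ _ f lf).
have /linear_bounded_continuous cg : bounded_near g (nbhs 0).
  apply/linear_boundedP; exists M; split=> [|r Mr y]; first exact: num_real.
  by apply: (le_trans (fM y)); rewrite ler_wpM2r// ltW.
exact: cg.
Qed.

Definition clin_of (f : E -> F) (M : R) (lf : linear f)
    (fM : forall x, `|f x| <= M * `|x|) : clinear E F :=
  CLinear (bounded_clin lf fM).

Lemma clinear_eq (f g : clinear E F) : (forall x, f x = g x) -> f = g.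
Proof. by move=> fg; apply: val_inj; apply/funext. Qed.

Lemma clinearDE (f g : clinear E F) x : (f + g) x = f x + g x.
Proof. by []. Qed.

Lemma clinearNE (f : clinear E F) x : (- f) x = - f x.
Proof. by []. Qed.

Lemma clinearZE k (f : clinear E F) x : (k *: f) x = k *: f x.
Proof. by []. Qed.

Lemma le_clinear_norm (f : clinear E F) x : `|f x| <= `|f| * `|x|.
Proof. exact: le_opnorm. Qed.

Lemma clinear_norm_le (f : clinear E F) M : 0 <= M ->
  (forall x, `|f x| <= M * `|x|) -> `|f| <= M.
Proof. exact: opnorm_le. Qed.

Lemma clinear_continuous (f : clinear E F) : continuous f.
Proof. exact: (clinearP f).2. Qed.

End BoundedLinear.

Section Frechet.
Context (R : realType).
Implicit Types E F G : normedModType R.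

Lemma is_diff_frechet E F (f : E -> F) x (L : clinear E F) :
  is_diff x f L -> frechet f x = L.
Proof.
move=> dL; have df : differentiable f x by exact: ex_diff.
by apply: clinear_eq => y; rewrite frechetE// diff_val.
Qed.

Lemma frechet_is_diff E F (f : E -> F) x :
  differentiable f x -> is_diff x f (frechet f x).
Proof. by move=> df; split=> //; rewrite frechetE. Qed.

Lemma is_diff_eps E F (f : E -> F) x (L : clinear E F) :
  (forall e : R, 0 < e ->
    \forall y \near x, `|f y - f x - L (y - x)| <= e * `|y - x|) ->
  is_diff x f L.
Proof.
move=> fL.
have key : f \o shift x = cst (f x) + L +o_ 0 id.
  apply/eqaddoP => e e0.
  change (\forall z \near (0 : E),
    `|(f \o shift x - (cst (f x) + L)) z| <= e * `|z|).
  rewrite (near_shift x) sub0r.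
  near=> y; rewrite !fctE /= subrK opprD addrA.
  by near: y; exact: fL.
(* ['d f x] is a chosen map; uniqueness of the linear part of the expansion identifies it with [L],
   and only then does the expansion state differentiability. *)
have dE : 'd f x = L :> (E -> F).
  by apply: diff_unique => //; exact: clinear_continuous.
split=> //; apply/diff_locallyP; rewrite dE; split=> //.
exact: clinear_continuous.
Unshelve. all: by end_near. Qed.

(** Locality of the derivative: it lets a total function be replaced by any formula that agrees with
    it on the open set under study. *)
Lemma frechet_near E F (f g : E -> F) (U : set E) x : open U -> U x ->
  {in U, f =1 g} -> differentiable f x ->
  differentiable g x /\ frechet g x = frechet f x.
Proof.
move=> oU Ux fg df.
have dg : is_diff x g (frechet f x).
  apply: is_diff_eps => e e0.
  have /diff_locally/eqaddoP/(_ e e0) := df.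
  move=> h0.
  have h : \forall y \near x, `|(f \o shift x - (cst (f x) + 'd f x)) (y - x)|
      <= e * `|y - x|.
    rewrite (near_shift 0 x) subr0 /=.
    by apply: filterS h0 => z; rewrite /= addrK.
  near=> y.
  have Uy : U y by near: y; exact: open_nbhs_nbhs.
  rewrite -!fg ?inE//.
  have : `|(f \o shift x - (cst (f x) + 'd f x)) (y - x)| <= e * `|y - x|.
    by near: y; exact: h.
  by rewrite !fctE /= subrK opprD addrA frechetE.
split; first exact: ex_diff.
exact: is_diff_frechet.
Unshelve. all: by end_near. Qed.

End Frechet.

(** * Calculus of C^k maps *)

Section CkCalculus.
Context (R : realType).
Implicit Types E F G H : normedModType R.

Lemma Ck_eq k E F (U : set E) (f g : E -> F) : open U ->
  {in U, f =1 g} -> Ck k U f -> Ck k U g.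
Proof.
elim: k F f g => [|k IH] F f g oU fg /=.
  move=> cf x Ux; rewrite /prop_for /continuous_at -fg ?inE//.
  apply: cvg_trans (cf x Ux); apply: near_eq_cvg.
  by near=> y; rewrite fg// inE; near: y; exact: open_nbhs_nbhs.
move=> [df Cf]; split.
  by move=> x Ux; exact: (frechet_near oU Ux fg (df x Ux)).1.
apply: (IH _ _ _ oU _ Cf) => x /set_mem Ux; symmetry.
exact: (frechet_near oU Ux fg (df x Ux)).2.
Unshelve. all: by end_near. Qed.

Lemma Ck_sub k E F (U V : set E) (f : E -> F) : V `<=` U -> Ck k U f -> Ck k V
  f.
Proof.
elim: k F f => [|k IH] F f VU /=; first by move=> cf x /VU; exact: cf.
by move=> [df Cf]; split; [move=> x /VU; exact: df|exact: IH].
Qed.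

Lemma CkW k E F (U : set E) (f : E -> F) : Ck k.+1 U f -> Ck k U f.
Proof.
elim: k F f => [|k IH] F f /= [df Cf].
  by move=> x Ux; exact/differentiable_continuous/df.
by split=> //; exact: IH.
Qed.

Lemma Ck_continuous k E F (U : set E) (f : E -> F) x : Ck k U f -> U x ->
  {for x, continuous f}.
Proof. by elim: k => [|k IH] Cf; [exact: Cf|exact/IH/CkW]. Qed.

(** The induction step of all regularity proofs: [frechet f] may be arbitrary outside [U], so it is
    traded for an explicit derivative [D] on [U]. *)
Lemma Ck_is_diff k E F (U : set E) (f : E -> F) (D : E -> clinear E F) :
  open U -> (forall x, U x -> is_diff x f (D x)) -> Ck k U D -> Ck k.+1 U f.
Proof.
move=> oU fD CD; split=> [x Ux|]; first by have [] := fD x Ux.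
apply: Ck_eq CD => // x; rewrite inE => Ux; symmetry.
by apply: is_diff_frechet; exact: fD.
Qed.

Lemma Ck_frechet k E F (U : set E) (f : E -> F) :
  Ck k.+1 U f -> Ck k U (frechet f).
Proof. by case. Qed.

Lemma Ck_diff k E F (U : set E) (f : E -> F) x :
  Ck k.+1 U f -> U x -> is_diff x f (frechet f x).
Proof. by move=> [df _] Ux; apply: frechet_is_diff; exact: df. Qed.

Lemma Ck_cst k E F (U : set E) (c : F) : open U -> Ck k U (fun=> c).
Proof.
move=> oU; elim: k F c => [|k IH] F c; first by move=> x _; exact: cvg_cst.
by apply: (@Ck_is_diff _ _ _ _ _ (fun=> 0)).
Qed.

Lemma Ck_clinear k E F (U : set E) (L : clinear E F) : open U -> Ck k U L.
Proof.
move=> oU; case: k => [|k]; first by move=> x _; exact: clinear_continuous.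
apply: (@Ck_is_diff _ _ _ _ _ (fun=> L)) => // [x _|]; last exact: Ck_cst.
by apply: is_diff_eps => e e0; near=> y; rewrite linearB/= subrr normr0
  mulr_ge0// ltW.
Unshelve. all: by end_near. Qed.

Lemma CkD k E F (U : set E) (f g : E -> F) : open U -> Ck k U f -> Ck k U g ->
  Ck k U (fun x => f x + g x).
Proof.
move=> oU; elim: k F f g => [|k IH] F f g Cf Cg.
  by move=> x Ux; apply: cvgD; [exact: Cf|exact: Cg].
apply: (@Ck_is_diff _ _ _ _ _ (fun x => frechet f x + frechet g x) oU).
  move=> x Ux; have := Ck_diff Cf Ux; have := Ck_diff Cg Ux => dg df.
  exact: is_diffD.
by apply: IH; exact: Ck_frechet.
Qed.

Lemma clin_comp_linear E F G (L : clinear F G) (T : clinear E F) :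
  linear (L \o T).
Proof. by move=> a x y /=; rewrite !linearP. Qed.

Lemma clin_comp_bound E F G (L : clinear F G) (T : clinear E F) x :
  `|(L \o T) x| <= (`|L| * `|T|) * `|x|.
Proof.
rewrite -mulrA; apply: (le_trans (le_clinear_norm _ _)).
by rewrite ler_wpM2l// le_clinear_norm.
Qed.

Definition clin_comp E F G (L : clinear F G) (T : clinear E F) : clinear E G :=
  clin_of (clin_comp_linear L T) (clin_comp_bound L T).

Lemma clin_comp_norm E F G (L : clinear F G) (T : clinear E F) :
  `|clin_comp L T| <= `|L| * `|T|.
Proof.
by apply: clinear_norm_le => [|x]; [rewrite mulr_ge0|exact: clin_comp_bound].
Qed.

Record bounded_bilinear E F G (B : E -> F -> G) (M : R) : Prop := BBil {
  bbil_l : forall y, linear (B^~ y);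
  bbil_r : forall x, linear (B x);
  bbil_le : forall x y, `|B x y| <= M * `|x| * `|y| }.

Lemma bounded_bilinear_ge0 E F G (B : E -> F -> G) M : bounded_bilinear B M ->
  exists2 N, 0 <= N & bounded_bilinear B N.
Proof.
move=> [Bl Br BM]; exists `|M| => //; split=> // x y.
by apply: (le_trans (BM x y)); rewrite -!mulrA ler_wpM2r ?mulr_ge0// ler_norm.
Qed.

Lemma comp_bounded_bilinear E F G : bounded_bilinear (@clin_comp E F G) 1.
Proof.
split=> [T a x y|L a x y|L T]; first exact: clinear_eq.
  by apply: clinear_eq => z; rewrite /= linearP.
by rewrite mul1r clin_comp_norm.
Qed.

Section BilinearDerivative.
Context E F G (B : E -> F -> G) (M : R) (bB : bounded_bilinear B M).

Let BDl x x' y : B (x + x') y = B x y + B x' y.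
Proof. by have := bbil_l bB y 1 x x'; rewrite !scale1r. Qed.
Let BDr x y y' : B x (y + y') = B x y + B x y'.
Proof. by have := bbil_r bB x 1 y y'; rewrite !scale1r. Qed.

Lemma bilin_app_linear x : linear (B x).
Proof. exact: bbil_r bB x. Qed.

Lemma bilin_app_bound x y : `|B x y| <= (`|M| * `|x|) * `|y|.
Proof.
apply: (le_trans (bbil_le bB x y)).
by rewrite -!mulrA ler_wpM2r ?mulr_ge0// ler_norm.
Qed.

Definition bilin_app x : clinear F G :=
  clin_of (bilin_app_linear x) (bilin_app_bound x).

Lemma bilin_app_lin : linear bilin_app.
Proof. by move=> a x y; apply: clinear_eq => z; exact: (bbil_l bB z). Qed.

Lemma bilin_app_norm x : `|bilin_app x| <= `|M| * `|x|.
Proof.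
by apply: clinear_norm_le => [|y]; [rewrite mulr_ge0|exact: bilin_app_bound].
Qed.

Definition curry_bilin : clinear E (clinear F G) :=
  clin_of bilin_app_lin bilin_app_norm.

End BilinearDerivative.

End CkCalculus.

(** * Product rule, chain rule and bootstrapping *)

Section CkBilinear.
Context (R : realType).
Implicit Types E F G H : normedModType R.

Lemma bilin_flip E F G (B : E -> F -> G) M : bounded_bilinear B M ->
  bounded_bilinear (fun y x => B x y) M.
Proof.
move=> [Bl Br BM]; split=> // y x.
by apply: (le_trans (BM x y)); rewrite -!mulrA (mulrC `|x|).
Qed.

(** One half of the derivative of [B (f z) (g z)] is [B (f z)] composed with the derivative of [g],
    again a bounded bilinear expression. This is what closes the induction in [Ck_bilin], where the
    spaces change at each step. *)
Lemma bilin_comp_bilinear E F G H (B : E -> F -> G) M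
    (bB : bounded_bilinear B M) :
  bounded_bilinear (fun x (T : clinear H F) => clin_comp (bilin_app bB x) T)
    `|M|.
Proof.
split=> [T a x y|x a S T|x T].
- by apply: clinear_eq => z; exact: (bbil_l bB).
- by apply: clinear_eq => z; exact: (bbil_r bB).
- apply: (le_trans (clin_comp_norm _ _)).
  by rewrite ler_wpM2r// bilin_app_norm.
Qed.

Lemma fst_bound E F (p : E * F) : `|p.1| <= 1 * `|p|.
Proof. by rewrite mul1r prod_normE le_max lexx. Qed.

Lemma snd_bound E F (p : E * F) : `|p.2| <= 1 * `|p|.
Proof. by rewrite mul1r prod_normE le_max lexx orbT. Qed.

Lemma inl_bound E F (x : E) : `|(x, 0 : F)| <= 1 * `|x|.
Proof. by rewrite mul1r prod_normE /= normr0 ge_max lexx normr_ge0. Qed.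

Lemma inr_bound E F (y : F) : `|(0 : E, y)| <= 1 * `|y|.
Proof. by rewrite mul1r prod_normE /= normr0 ge_max lexx normr_ge0. Qed.

Fact fst_linear E F : linear (fun p : E * F => p.1). Proof. by []. Qed.
Fact snd_linear E F : linear (fun p : E * F => p.2). Proof. by []. Qed.
Fact inl_linear E F : linear (fun x : E => (x, 0 : F)).
Proof. by move=> a x y; congr (_, _); rewrite /= scaler0 addr0. Qed.
Fact inr_linear E F : linear (fun y : F => (0 : E, y)).
Proof. by move=> a x y; congr (_, _); rewrite /= scaler0 addr0. Qed.

Definition cfst E F : clinear (E * F)%type E :=
  clin_of (@fst_linear E F) (@fst_bound E F).
Definition csnd E F : clinear (E * F)%type F :=
  clin_of (@snd_linear E F) (@snd_bound E F).
Definition cinl E F : clinear E (E * F)%type :=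
  clin_of (@inl_linear E F) (@inl_bound E F).
Definition cinr E F : clinear F (E * F)%type :=
  clin_of (@inr_linear E F) (@inr_bound E F).

Section Derivative.
Context E F G (B : E -> F -> G) (M : R) (bB : bounded_bilinear B M).

Lemma bilinBB x x' y y' :
  B x' y' - B x y = B (x' - x) (y' - y) + B x (y' - y) + B (x' - x) y.
Proof.
have BDl u v w : B (u + v) w = B u w + B v w.
  by have := bbil_l bB w 1 u v; rewrite !scale1r.
have BDr u v w : B u (v + w) = B u v + B u w.
  by have := bbil_r bB u 1 v w; rewrite !scale1r.
rewrite -BDl subrK; apply: (addIr (B x y)).
by rewrite subrK -addrA -BDl subrK -BDr subrK.
Qed.

Definition bilin_diff (p : E * F) : clinear (E * F)%type G :=
  clin_comp (bilin_app bB p.1) (csnd E F) +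
  clin_comp (bilin_app (bilin_flip bB) p.2) (cfst E F).

Lemma is_diff_bilin (p : E * F) :
  is_diff p (fun q : E * F => B q.1 q.2) (bilin_diff p).
Proof.
apply: is_diff_eps => e e0.
have M0 : 0 < `|M| + 1 by rewrite ltr_wpDl.
(* The remainder is exactly [B (q.1 - p.1) (q.2 - p.2)], which is quadratic in [q - p]. The [+ 1]
   keeps the radius [e / (|M| + 1)] meaningful when [M = 0]. *)
near=> q; rewrite bilinBB clinearDE /= -[X in X - _]addrA addrK.
rewrite (le_trans (bbil_le bB _ _))//.
have le1 : `|q.1 - p.1| <= `|q - p| by have := fst_bound (q - p); rewrite mul1r.
have le2 : `|q.2 - p.2| <= `|q - p| by have := snd_bound (q - p); rewrite mul1r.
have qp : `|q - p| <= e / (`|M| + 1).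
  near: q; apply/nbhs_ballP; exists (e / (`|M| + 1)); first exact: divr_gt0.
  by move=> q; rewrite -ball_normE /= distrC => /ltW.
have {}qp : (`|M| + 1) * `|q - p| <= e by rewrite mulrC -ler_pdivlMr.
apply: le_trans (ler_wpM2r (normr_ge0 (q - p)) qp).
apply: (@le_trans _ _ ((`|M| + 1) * `|q.1 - p.1| * `|q.2 - p.2|)).
  by rewrite -!mulrA ler_wpM2r ?mulr_ge0// (le_trans (ler_norm M))// lerDl.
by rewrite -!mulrA (ler_wpM2l (ltW M0))// ler_pM.
Unshelve. all: by end_near. Qed.

End Derivative.

Lemma Ck_bilin k E F G H (U : set H) (B : E -> F -> G) M f g : open U ->
  bounded_bilinear B M -> Ck k U f -> Ck k U g ->
  Ck k U (fun z => B (f z) (g z)).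
Proof.
elim: k E F G B M f g => [|k IH] E F G B M f g oU bB Cf Cg.
  move=> x Ux.
  apply: (@continuous_comp _ _ _ (fun z => (f z, g z)) (fun q => B q.1 q.2)).
    by apply: cvg_pair; [exact: Cf|exact: Cg].
  by apply: differentiable_continuous; have [] := is_diff_bilin bB (f x, g x).
pose D z : clinear H G := clin_comp (bilin_app bB (f z)) (frechet g z) +
  clin_comp (bilin_app (bilin_flip bB) (g z)) (frechet f z).
apply: (@Ck_is_diff R k H G U (fun z => B (f z) (g z)) D oU).
  move=> x Ux.
  have df := Ck_diff Cf Ux; have dg := Ck_diff Cg Ux.
  have dfg := is_diff_pair df dg.
  exact: (is_diff_comp dfg (is_diff_bilin bB (f x, g x))).
apply: (CkD oU).
  apply: (IH _ _ _ _ _ _ _ oU (bilin_comp_bilinear H bB));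
    last exact: Ck_frechet.
  exact: CkW.
apply: (IH _ _ _ _ _ _ _ oU (bilin_comp_bilinear H (bilin_flip bB)));
  last exact: Ck_frechet.
exact: CkW.
Qed.

(** The derivative of the composite pairs [frechet g \o f] with [frechet f] through the bounded
    bilinear map [clin_comp]; the induction hypothesis applies to the former, with another target
    space. *)
Lemma Ck_comp k E F G (U : set E) (V : set F) (f : E -> F) (g : F -> G) :
  open U -> open V -> (forall x, U x -> V (f x)) -> Ck k U f -> Ck k V g ->
  Ck k U (g \o f).
Proof.
elim: k E F G U V f g => [|k IH] E F G U V f g oU oV UV Cf Cg.
  move=> x Ux; apply: continuous_comp; first exact: Cf.
  exact/Cg/UV.
apply: (@Ck_is_diff _ _ _ _ _ _ (fun x =>
  clin_comp ((frechet g \o f) x) (frechet f x)) oU).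
  move=> x Ux.
  exact: (is_diff_comp (Ck_diff Cf Ux) (Ck_diff Cg (UV _ Ux))).
apply: (Ck_bilin oU (comp_bounded_bilinear _ _ _)); last exact: Ck_frechet.
by apply: (IH _ _ _ _ V) => //; [exact: CkW|exact: Ck_frechet].
Qed.

Lemma Ck_clin k E F G (U : set E) (f : E -> F) (L : clinear F G) : open U ->
  Ck k U f -> Ck k U (fun x => L (f x)).
Proof.
move=> oU Cf; apply: (@Ck_comp _ _ _ _ U setT f L) => //; first exact: openT.
by apply: Ck_clinear; exact: openT.
Qed.

Lemma Ck_fst k E F G (U : set E) (f : E -> F * G) : open U -> Ck k U f ->
  Ck k U (fun x => (f x).1).
Proof. exact: (@Ck_clin _ _ _ _ _ _ (cfst F G)). Qed.

Lemma Ck_snd k E F G (U : set E) (f : E -> F * G) : open U -> Ck k U f ->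
  Ck k U (fun x => (f x).2).
Proof. exact: (@Ck_clin _ _ _ _ _ _ (csnd F G)). Qed.

Lemma Ck_pair k E F G (U : set E) (f : E -> F) (g : E -> G) : open U ->
  Ck k U f -> Ck k U g -> Ck k U (fun x => (f x, g x)).
Proof.
move=> oU Cf Cg.
have := CkD oU (Ck_clin (cinl F G) oU Cf) (Ck_clin (cinr F G) oU Cg).
apply: Ck_eq => // x _ /=.
by congr (_, _); rewrite /= ?addr0 ?add0r.
Qed.

(* If [j] solves an equation whose difference quotients are [K (j x, j y)] with
   [K] smooth, then the derivative of [j] is [K (j x, j x)], which is as regular
   as [j] itself; so regularity bootstraps from continuity.  This covers
   inversion in a Banach algebra (resolvent identity) and square roots. *)
Lemma Ck_bootstrap k E F (U : set E) (V : set (F * F)) (j : E -> F)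
    (K : F * F -> clinear E F) : open U -> open V ->
  (forall x y, U x -> U y -> V (j x, j y)) ->
  (forall x y, U x -> U y -> j y - j x = K (j x, j y) (y - x)) ->
  (forall x, U x -> {for x, continuous j}) -> (forall k, Ck k V K) ->
  Ck k U j.
Proof.
move=> oU oV UV jK cj CK.
elim: k => [|k IH]; first exact: cj.
apply: (@Ck_is_diff _ _ _ _ _ _ (fun x => K (j x, j x)) oU); last first.
  apply: (@Ck_comp k _ _ _ U V (fun x => (j x, j x)) K) => //.
    by move=> x Ux; exact: UV.
  exact: Ck_pair.
move=> x Ux; apply: is_diff_eps => e e0.
have cK : {for x, continuous (fun y => K (j x, j y))}.
  apply: (@continuous_comp _ _ _ (fun y => (j x, j y)) K).
    by apply: cvg_pair; [exact: cvg_cst|exact: cj].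
  by apply: (Ck_continuous (CK 0)); exact: UV.
near=> y.
have Uy : U y by near: y; exact: open_nbhs_nbhs.
rewrite jK// -clinearNE -clinearDE (le_trans (le_clinear_norm _ _))//.
rewrite ler_wpM2r//.
near: y.
have /cvgrPdist_le/(_ e e0) := cK.
by apply: filterS => y; rewrite distrC.
Unshelve. all: by end_near. Qed.
End CkBilinear.

Section CkMore.
Context (R : realType).
Implicit Types E F G : normedModType R.

Lemma opp_linear E : linear (fun x : E => - x).
Proof. by move=> a x y; rewrite scalerN opprD. Qed.

Lemma opp_bound E (x : E) : `|- x| <= 1 * `|x|.
Proof. by rewrite normrN mul1r. Qed.

Definition copp E : clinear E E := clin_of (@opp_linear E) (@opp_bound E).

Lemma CkN k E F (U : set E) (f : E -> F) : open U -> Ck k U f ->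
  Ck k U (fun x => - f x).
Proof. exact: (@Ck_clin _ _ _ _ _ _ _ (copp F)). Qed.

Lemma CkB k E F (U : set E) (f g : E -> F) : open U -> Ck k U f -> Ck k U g ->
  Ck k U (fun x => f x - g x).
Proof. by move=> oU Cf Cg; apply: (CkD oU Cf); exact: CkN. Qed.

Lemma id_linear E : linear (fun x : E => x). Proof. by []. Qed.

Lemma id_bound E (x : E) : `|x| <= 1 * `|x|. Proof. by rewrite mul1r. Qed.

Definition cid E : clinear E E := clin_of (@id_linear E) (@id_bound E).

Lemma Ck_id k E (U : set E) : open U -> Ck k U (fun x => x).
Proof. exact: (@Ck_clinear _ _ _ _ _ (cid E)). Qed.

Lemma open_preimage_in E F (U : set E) (V : set F) (f : E -> F) : open U ->
  open V -> (forall x, U x -> {for x, continuous f}) -> open (U `&` f @^-1` V).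
Proof.
move=> oU oV cf; rewrite openE => x [Ux Vfx]; apply: filterI.
  exact: open_nbhs_nbhs.
by apply: (cf x Ux); exact: open_nbhs_nbhs.
Qed.

Lemma continuous_dist_le E F (j : E -> F) x (C : R) (P : set E) :
  (\forall y \near x, P y) -> 0 <= C ->
  (forall y, P y -> `|j y - j x| <= C * `|y - x|) -> {for x, continuous j}.
Proof.
move=> Px C0 jC; apply/cvgrPdist_le => e e0.
have C1 : 0 < C + 1 by rewrite ltr_wpDl.
near=> y; have Py : P y by near: y.
rewrite distrC (le_trans (jC y Py))//.
rewrite (@le_trans _ _ ((C + 1) * `|y - x|))//.
  by rewrite ler_wpM2r// lerDl.
rewrite mulrC -ler_pdivlMr//.
near: y; apply/nbhs_ballP; exists (e / (C + 1)); first by rewrite /= divr_gt0.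
by move=> y; rewrite -ball_normE /= distrC => /ltW.
Unshelve. all: by end_near. Qed.

(** Continuity, an assumption of [Ck_bootstrap], is here a consequence of the equation. When
    [N |j x| |y - x| <= 1/2], the term in [|j y|] on the right is absorbed, so [|j y| <= 2 |j x|],
    and the equation becomes a Lipschitz estimate at [x]. *)
Lemma Ck_resolvent k E F (U : set E) (j : E -> F) (B : F -> F -> clinear E F) M
  :
  open U -> bounded_bilinear B M ->
  (forall x y, U x -> U y -> j y - j x = B (j x) (j y) (y - x)) -> Ck k U j.
Proof.
move=> oU /bounded_bilinear_ge0[N N0 bB] jB.
apply: (@Ck_bootstrap R k E F U setT j (fun p => B p.1 p.2)) => //.
- exact: openT.
- move=> x Ux.
  have jle y : U y -> `|j y - j x| <= N * `|j x| * `|j y| * `|y - x|.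
    move=> Uy; rewrite jB// (le_trans (le_clinear_norm _ _))// ler_wpM2r//.
    exact: (bbil_le bB).
  pose P y := U y /\ N * `|j x| * `|y - x| <= 2^-1.
  have C0 : 0 <= N * `|j x| * (2 * `|j x|) by rewrite !mulr_ge0.
  apply: (@continuous_dist_le _ _ _ _ (N * `|j x| * (2 * `|j x|)) P) => //.
    have D0 : 0 < N * `|j x| + 1 by rewrite ltr_wpDl ?mulr_ge0.
    near=> y; split; first by near: y; exact: open_nbhs_nbhs.
    rewrite (@le_trans _ _ ((N * `|j x| + 1) * `|y - x|))//.
      by rewrite ler_wpM2r// lerDl.
    rewrite mulrC -ler_pdivlMr//; near: y; apply/nbhs_ballP.
    exists (2^-1 / (N * `|j x| + 1)); first by rewrite /= divr_gt0.
    by move=> y; rewrite -ball_normE /= distrC => /ltW.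
  move=> y [Uy yx]; apply: (le_trans (jle y Uy)).
  rewrite ler_wpM2r// ler_wpM2l ?mulr_ge0//.
  have : `|j y| <= `|j x| + `|j y| / 2.
    rewrite -{1}(subrK (j x) (j y)) addrC (le_trans (ler_normD _ _))// lerD2l.
    apply: (le_trans (jle y Uy)).
    rewrite (_ : N * _ * _ * _ = (N * `|j x| * `|y - x|) * `|j y|);
      last by ring.
    by rewrite [leRHS]mulrC ler_wpM2r.
  lra.
- move=> m; apply: (Ck_bilin openT bB); [apply: Ck_fst|apply: Ck_snd];
    by [exact: openT|apply: Ck_id; exact: openT].
Unshelve. all: by end_near. Qed.

End CkMore.

(** * Real norm and scalars of a C*-algebra *)

Section RealNorm.
Context (R : realType) (A : cstarAlgType R).
Implicit Types (x y z : A) (s t : R).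

Definition nrm x : R := `|(x : realify A)|.

Lemma nrmE x : (nrm x)%:C = `|x|.
Proof. by rewrite /nrm /Num.norm /= RRe_real // normr_real. Qed.

Lemma nrm_ge0 x : 0 <= nrm x. Proof. exact: normr_ge0. Qed.
Lemma nrm0 : nrm 0 = 0. Proof. exact: normr0. Qed.
Lemma nrmN x : nrm (- x) = nrm x. Proof. exact: normrN. Qed.
Lemma nrmD x y : nrm (x + y) <= nrm x + nrm y. Proof. exact: ler_normD. Qed.
Lemma nrm_eq0 x : nrm x = 0 -> x = 0. Proof. exact: normr0_eq0. Qed.

Lemma nrmM x y : nrm (x * y) <= nrm x * nrm y.
Proof. by rewrite -lecR rmorphM /= !nrmE ler_normM. Qed.

Lemma nrm_cstar x : nrm (star x * x) = nrm x ^+ 2.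
Proof. by apply: complexI; rewrite rmorphXn /= !nrmE cstar_identity. Qed.

Lemma nrmZ (k : R[i]) x : (nrm (k *: x))%:C = `|k| * (nrm x)%:C.
Proof. by rewrite !nrmE normrZ. Qed.

Lemma nrm_star x : nrm (star x) = nrm x.
Proof.
have le y : nrm y <= nrm (star y).
  have [y0|y0] := eqVneq (nrm y) 0; first by rewrite y0 nrm_ge0.
  have {}y0 : 0 < nrm y by rewrite lt_neqAle eq_sym y0 nrm_ge0.
  by rewrite -(ler_pM2r y0) -expr2 -nrm_cstar nrmM.
by apply/eqP; rewrite eq_le le -{2}(starK x) le.
Qed.

End RealNorm.

(** * Completeness of the underlying real space *)

Section Complete.
Context (R : realType) (A : cstarAlgType R).

Let realify_complete (F : set_system (realify A)) :
  ProperFilter F -> cauchy F -> cvg F.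
Proof.
move=> PF cF.
have cFA : cauchy (F : set_system A).
  apply: cauchy_exP => e e0.
  (* A positive element of [R[i]] is real, so the two norms have the same balls. *)
  have eE : e = (complex.Re e)%:C by rewrite RRe_real // gtr0_real.
  have re0 : 0 < complex.Re e by rewrite -ltcR -eE.
  have [x Fx] : exists x : realify A, F (ball x (complex.Re e)) by
    move/cauchyP: cF; apply.
  exists x; apply: filterS Fx => y.
  by rewrite -!ball_normE /= -ltcR nrmE -eE.
have /cvg_ex[l Fl] : cvg (F : set_system A) by exact: cauchy_cvg.
apply/cvg_ex; exists l; apply/cvg_ballP => e e0.
have e0' : 0 < e%:C by rewrite ltcR.
have /cvg_ballP/(_ _ e0') := Fl.
apply: filterS => y.
by rewrite -!ball_normE /= -nrmE ltcR.
Qed.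

HB.instance Definition _ := Uniform_isComplete.Build (realify A)
  realify_complete.
End Complete.

Lemma contraction_fixpoint (R : realType) (X : completeNormedModType R)
    (U : set X) (f : X -> X) (q : R) : closed U -> U !=set0 ->
  (forall x, U x -> U (f x)) -> 0 <= q < 1 ->
  (forall x y, U x -> U y -> `|f x - f y| <= q * `|x - y|) ->
  exists2 x, U x & x = f x.
Proof.
move=> cU U0 fU /andP[q0 q1] fq.
pose g : {fun U >-> U} := mkfun fU.
apply: (@banach_fixed_point R X U g) => //.
exists (NngNum q0); split=> //= -[x y] /= [Ux Uy]; exact: fq.
Qed.

Section Scalars.
Context (R : realType) (A : cstarAlgType R).
Implicit Types (x y z : A) (s t : R).

(** Real scalars as central elements of the ring: scaling becomes a product, and every identity is
    one in a noncommutative ring. *)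
Definition sc t : A := t%:C *: (1 : A).

Lemma scE t x : sc t * x = t%:C *: x.
Proof. by rewrite /sc -[LHS](@cscalerAl R A) [cmul _ _]mul1r. Qed.

Lemma scEr t x : x * sc t = t%:C *: x.
Proof. by rewrite /sc -[LHS](@cscalerAr R A) [cmul _ _]mulr1. Qed.

Lemma sc_comm t x : sc t * x = x * sc t.
Proof. by rewrite scE scEr. Qed.

Lemma scD s t : sc (s + t) = sc s + sc t.
Proof. by rewrite /sc rmorphD scalerDl. Qed.

Lemma scN t : sc (- t) = - sc t.
Proof. by rewrite /sc rmorphN scaleNr. Qed.

Lemma scB s t : sc (s - t) = sc s - sc t.
Proof. by rewrite scD scN. Qed.

Lemma scM s t : sc (s * t) = sc s * sc t.
Proof. by rewrite scE /sc scalerA rmorphM. Qed.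

Lemma sc0 : sc 0 = 0. Proof. by rewrite /sc scale0r. Qed.
Lemma sc1 : sc 1 = 1. Proof. by rewrite /sc scale1r. Qed.

Lemma scK t x : t != 0 -> sc t^-1 * (sc t * x) = x.
Proof. by move=> t0; rewrite mulrA -scM mulVf// sc1 mul1r. Qed.

Lemma scVK t x : t != 0 -> sc t * (sc t^-1 * x) = x.
Proof. by move=> t0; rewrite mulrA -scM mulfV// sc1 mul1r. Qed.

Lemma starMr x y : star (x * y) = star y * star x.
Proof. exact: starM. Qed.

Lemma star0 : star 0 = 0 :> A.
Proof. by have := @starZ R A 0 0; rewrite rmorph0 !scale0r. Qed.

Lemma star1 : star 1 = 1 :> A.
Proof. by have := congr1 (@star R A) (mul1r (star 1));
  rewrite starMr starK mul1r. Qed.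

Lemma starB x y : star (x - y) = star x - star y.
Proof. by rewrite starD starN. Qed.

Lemma star_sc t : star (sc t) = sc t.
Proof. by rewrite starZ star1 [_^*]conjc_real. Qed.

Lemma nrm_sc t x : nrm (sc t * x) = `|t| * nrm x.
Proof.
apply: complexI; rewrite rmorphM /= scE nrmZ; congr (_ * _).
by rewrite normc_def /= expr0n addr0 sqrtr_sqr.
Qed.

(** The C*-identity makes the norm of [1] idempotent, hence [0] or [1]; the value [0] occurs in the
    zero algebra. *)
Lemma nrm1_le : nrm (1 : A) <= 1.
Proof.
have := nrm_cstar (1 : A); rewrite star1 mul1r expr2 => /eqP.
rewrite -subr_eq0 -{1}[nrm 1]mulr1 -mulrBr mulf_eq0 => /orP[/eqP->//|].
by rewrite subr_eq0 => /eqP <-.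
Qed.

Lemma nrm_sc_le t : nrm (sc t) <= `|t|.
Proof.
by rewrite -[sc t]mulr1 nrm_sc ler_piMr// nrm1_le.
Qed.

End Scalars.

(* Identities in the noncommutative ring [A] with central real scalars [sc t]
   are decided by expanding both sides into signed sums of monomials. *)
Section NcRing.
Context (R : realType) (A : cstarAlgType R).

Inductive nc_expr :=
  | NcVar of nat | NcScalar of nat | NcOne | NcZero
  | NcAdd of nc_expr & nc_expr | NcMul of nc_expr & nc_expr | NcOpp of nc_expr.

(* Scalar variables, then algebra variables. *)
Definition nc_mono := (seq nat * seq nat)%type.

(** Only the scalar factors are sorted: they are central, whereas the order of the algebra factors
    matters. *)
Definition nc_mono_mul (m n : nc_mono) : nc_mono :=
  (sort leq (m.1 ++ n.1), m.2 ++ n.2).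

Definition nc_muls (s t : seq nc_mono) := [seq nc_mono_mul m n | m <- s, n <-
  t].

Fixpoint nc_expand (e : nc_expr) : seq nc_mono * seq nc_mono :=
  match e with
  | NcVar i => ([:: ([::], [:: i])], [::])
  | NcScalar i => ([:: ([:: i], [::])], [::])
  | NcOne => ([:: ([::], [::])], [::])
  | NcZero => ([::], [::])
  | NcAdd a b => let p := nc_expand a in let q := nc_expand b in
      (p.1 ++ q.1, p.2 ++ q.2)
  | NcOpp a => let p := nc_expand a in (p.2, p.1)
  | NcMul a b => let p := nc_expand a in let q := nc_expand b in
      (nc_muls p.1 q.1 ++ nc_muls p.2 q.2, nc_muls p.1 q.2 ++ nc_muls p.2 q.1)
  end.

Variables (es : seq R) (ea : seq A).

Fixpoint nc_eval (e : nc_expr) : A :=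
  match e with
  | NcVar i => nth 0 ea i
  | NcScalar i => sc A (nth 0 es i)
  | NcOne => 1
  | NcZero => 0
  | NcAdd a b => nc_eval a + nc_eval b
  | NcMul a b => nc_eval a * nc_eval b
  | NcOpp a => - nc_eval a
  end.

Definition nc_mono_eval (m : nc_mono) : A :=
  sc A (\prod_(i <- m.1) nth 0 es i) * \prod_(i <- m.2) nth 0 ea i.

Definition nc_sum (s : seq nc_mono) : A := \sum_(m <- s) nc_mono_eval m.

Lemma nc_mono_mulE m n :
  nc_mono_eval (nc_mono_mul m n) = nc_mono_eval m * nc_mono_eval n.
Proof.
rewrite /nc_mono_eval /= (perm_big _ (permEl (perm_sort _ _))) !big_cat /= scM.
by rewrite !mulrA; congr (_ * _); rewrite -!mulrA; congr (_ * _);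
  rewrite sc_comm.
Qed.

Lemma nc_mulsE s t : nc_sum (nc_muls s t) = nc_sum s * nc_sum t.
Proof.
rewrite /nc_sum /nc_muls big_allpairs_dep mulr_suml; apply: eq_bigr => m _.
by rewrite mulr_sumr; apply: eq_bigr => n _; exact: nc_mono_mulE.
Qed.

Lemma nc_expandE e :
  nc_eval e = nc_sum (nc_expand e).1 - nc_sum (nc_expand e).2.
Proof.
have sumU s t : nc_sum (s ++ t) = nc_sum s + nc_sum t by exact: big_cat.
have sum0 : nc_sum [::] = 0 by exact: big_nil.
have sum1 m : nc_sum [:: m] = nc_mono_eval m by exact: big_seq1.
elim: e => [i|i|||a IHa b IHb|a IHa b IHb|a IHa] /=.
- by rewrite sum0 sum1 /nc_mono_eval /= big_nil big_seq1 sc1 mul1r subr0.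
- by rewrite sum0 sum1 /nc_mono_eval /= big_nil big_seq1 mulr1 subr0.
- by rewrite sum0 sum1 /nc_mono_eval /= !big_nil sc1 mulr1 subr0.
- by rewrite sum0 subr0.
- by rewrite !sumU IHa IHb opprD addrACA.
- rewrite !sumU !nc_mulsE IHa IHb mulrBl !mulrBr.
  by rewrite opprB addrACA -opprD.
- by rewrite IHa opprB.
Qed.

(** Negative monomials move to the other side, so integer coefficients never occur and cancellation
    reduces to comparing multisets. *)
Lemma nc_correct e f :
  perm_eq ((nc_expand e).1 ++ (nc_expand f).2)
          ((nc_expand f).1 ++ (nc_expand e).2) -> nc_eval e = nc_eval f.
Proof.
move=> ef; rewrite !nc_expandE; apply/eqP;
  rewrite subr_eq addrAC eq_sym subr_eq.
by apply/eqP; have := perm_big (op := +%R) (x := 0) (F := nc_mono_eval) (P :=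
  xpredT) _ ef; rewrite !big_cat.
Qed.

End NcRing.

Ltac nc_insert x l :=
  lazymatch l with
  | context [x :: _] => l
  | _ => constr:(x :: l)
  end.

Ltac nc_index x l :=
  lazymatch l with
  | x :: _ => constr:(0%N)
  | _ :: ?l' => let n := nc_index x l' in constr:(n.+1)
  end.

Ltac nc_atoms t ls la :=
  let binary x y :=
    let p := nc_atoms x ls la in
    lazymatch p with (?ls', ?la') => nc_atoms y ls' la' end in
  lazymatch t with
  | (?x + ?y)%R => binary x y
  | (?x * ?y)%R => binary x y
  | (- ?x)%R => nc_atoms x ls la
  | 1%R => constr:((ls, la))
  | 0%R => constr:((ls, la))
  | sc _ ?s => let ls' := nc_insert s ls in constr:((ls', la))
  | ?x => let la' := nc_insert x la in constr:((ls, la'))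
  end.

Ltac nc_reify t ls la :=
  lazymatch t with
  | (?x + ?y)%R => let a := nc_reify x ls la in let b := nc_reify y ls la in
                   constr:(NcAdd a b)
  | (?x * ?y)%R => let a := nc_reify x ls la in let b := nc_reify y ls la in
                   constr:(NcMul a b)
  | (- ?x)%R => let a := nc_reify x ls la in constr:(NcOpp a)
  | 1%R => constr:(NcOne)
  | 0%R => constr:(NcZero)
  | sc _ ?s => let i := nc_index s ls in constr:(NcScalar i)
  | ?x => let i := nc_index x la in constr:(NcVar i)
  end.

Ltac nc_ring :=
  rewrite ?(scD, scN, scM, sc1, sc0);
  match goal with
  | A : CStarAlgebra.type ?R |- @eq _ ?x ?y =>
    let p := nc_atoms x (@nil (Real.sort R)) (@nil (CStarAlgebra.sort A)) in
    lazymatch p with (?ls, ?la) =>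
      let q := nc_atoms y ls la in
      lazymatch q with (?ls', ?la') =>
        let a := nc_reify x ls' la' in
        let b := nc_reify y ls' la' in
        change (@nc_eval R A ls' la' a = @nc_eval R A ls' la' b);
        apply: nc_correct; vm_compute; reflexivity
      end
    end
  end.

(** * Sylvester equations and square roots *)

Section Sylvester.
Context (R : realType) (A : cstarAlgType R).
Implicit Types (a b c d h x y z : A) (s t : R).

(** The operator differs from multiplication by [s + t] by [h |-> (s - c) h + h (t - d)], of norm at
    most [|s - c| + |t - d|]. The gap between the two numbers bounds the operator from below. *)
Lemma sylvester_bound c d s t h : 0 <= s + t ->
  (s + t - (nrm (sc A s - c) + nrm (sc A t - d))) * nrm h <= nrm (c * h + h *
    d).
Proof.
move=> st0; rewrite mulrBl lerBlDr (mulrDl (nrm _)).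
have -> : (s + t) * nrm h = nrm (sc A (s + t) * h).
  by rewrite nrm_sc ger0_norm.
have -> : sc A (s + t) * h =
    (c * h + h * d) + ((sc A s - c) * h + h * (sc A t - d)) by nc_ring.
rewrite (le_trans (nrmD _ _))// lerD2l (le_trans (nrmD _ _))// lerD ?nrmM//.
by rewrite mulrC nrmM.
Qed.

(** The fixed point of [h |-> (b + (s - c) h + h (t - d)) / (s + t)]. Only the sum of the two
    defects has to be small, so that one of [c], [d] may be [0]. *)
Lemma sylvester_solve c d s t b :
  nrm (sc A s - c) + nrm (sc A t - d) < s + t -> exists h, c * h + h * d = b.
Proof.
move=> lt_st; set k := _ + _ in lt_st.
have k0 : 0 <= k by rewrite addr_ge0// nrm_ge0.
have st0 : 0 < s + t by rewrite (le_lt_trans k0).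
pose f (h : realify A) : realify A :=
  sc A (s + t)^-1 * (b + ((sc A s - c) * h + h * (sc A t - d))).
have [||h _ hE] := @contraction_fixpoint R (realify A) setT f ((s + t)^-1 * k)
    closedT (ex_intro _ 0 I) (fun _ _ => I).
- by rewrite mulr_ge0 ?invr_ge0 ?(ltW st0)//= mulrC ltr_pdivrMr// mul1r.
- move=> x y _ _.
  have -> : f x - f y = sc A (s + t)^-1 *
      ((sc A s - c) * (x - y : A) + (x - y : A) * (sc A t - d)).
    rewrite /f; set r := sc A _^-1; move: (x : A) (y : A) => {}x {}y; nc_ring.
  rewrite [leLHS]nrm_sc ger0_norm ?invr_ge0 ?(ltW st0)// -mulrA.
  rewrite ler_wpM2l ?invr_ge0 ?(ltW st0)// (le_trans (nrmD _ _))// /k (mulrDl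
    (nrm _)).
  by rewrite lerD ?nrmM// mulrC nrmM.
exists h; have := congr1 (fun z : A => sc A (s + t) * z) hE.
rewrite /f scVK ?gt_eqF// => {hE}; move: (h : A) => {}h hE.
apply: (addIr ((sc A s - c) * h + h * (sc A t - d))).
by rewrite -hE; nc_ring.
Qed.

Definition ppos a := exists t : R, nrm (sc A t - a) < t.

Lemma sylvester_inj c d x y : ppos c -> ppos d ->
  c * x + x * d = c * y + y * d -> x = y.
Proof.
move=> [s cs] [t dt] xy.
have s0 : 0 < s by rewrite (le_lt_trans _ cs) ?nrm_ge0.
have t0 : 0 < t by rewrite (le_lt_trans _ dt) ?nrm_ge0.
apply/eqP; rewrite -subr_eq0; apply/eqP/nrm_eq0/eqP.
have := @sylvester_bound c d s t (x - y) (ltW (addr_gt0 s0 t0)).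
have -> : c * (x - y) + (x - y) * d = (c * x + x * d) - (c * y + y * d) by
  nc_ring.
rewrite xy subrr nrm0 pmulr_rle0 ?subr_gt0 ?ltrD// => h.
by rewrite eq_le h nrm_ge0.
Qed.

Lemma inverse_unique x y z : is_inverse x y -> is_inverse x z -> y = z.
Proof. by move=> [_ yx] [xz _]; rewrite -[y]mulr1 -xz mulrA yx mul1r. Qed.

Lemma inverseP x : invertible x -> is_inverse x (inverse x).
Proof. by move=> [y xy]; apply: (@xgetPex _ 0 [set y | is_inverse x y]);
  exists y. Qed.

Lemma is_inverseE x y : is_inverse x y -> inverse x = y.
Proof. by move=> xy; apply: (inverse_unique (inverseP (ex_intro _ y xy))). Qed.

Lemma mulxV x : invertible x -> x * inverse x = 1.
Proof. by move/inverseP => []. Qed.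

Lemma mulVx x : invertible x -> inverse x * x = 1.
Proof. by move/inverseP => []. Qed.

Lemma invertible_lr x y z : x * y = 1 -> z * x = 1 -> invertible x.
Proof.
move=> xy zx; exists y; split=> //.
by rewrite -[y]mul1r -zx -(mulrA z) xy mulr1.
Qed.

(** The degenerate Sylvester equations [a h = 1] and [h a = 1] give a right and a left inverse. *)
Lemma ppos_invertible a : ppos a -> invertible a.
Proof.
move=> [t at0].
have [|y ay] := @sylvester_solve a 0 t 0 1;
  first by rewrite sc0 subr0 nrm0 !addr0.
have [|z az] := @sylvester_solve 0 a 0 t 1;
  first by rewrite sc0 subr0 nrm0 !add0r.
by move: ay az; rewrite mulr0 addr0 mul0r add0r; exact: invertible_lr.
Qed.

Lemma invertibleM x y : invertible x -> invertible y -> invertible (x * y).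
Proof.
move=> [x' [xx' x'x]] [y' [yy' y'y]]; exists (y' * x'); split.
  by rewrite mulrA -(mulrA x) yy' mulr1.
by rewrite mulrA -(mulrA y') x'x mulr1.
Qed.

Lemma star_is_inverse x y : is_inverse x y -> is_inverse (star x) (star y).
Proof. by move=> [xy yx]; split; rewrite -starMr ?xy ?yx star1. Qed.

Lemma invertible_star x : invertible x -> invertible (star x).
Proof. by move=> [y /star_is_inverse]; exists (star y). Qed.

Lemma star_inverse x : invertible x -> star (inverse x) = inverse (star x).
Proof. by move=> /inverseP/star_is_inverse/is_inverseE. Qed.

Lemma commute_inverse x y : invertible x -> x * y = y * x ->
  inverse x * y = y * inverse x.
Proof.
move=> ix xy; rewrite -[LHS]mulr1 -(mulxV ix) mulrA -(mulrA _ y) -xy.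
by rewrite mulrA mulVx// mul1r.
Qed.

Lemma invertible_comm_factor x y : x * y = y * x -> invertible (x * y) ->
  invertible x.
Proof.
move=> xy [z [xyz zxy]]; apply: (@invertible_lr _ (y * z) (z * y)).
  by rewrite mulrA.
by rewrite -mulrA -xy.
Qed.

(** For [t = 1] the geometric series suggests [(1 - y x)^-1 = 1 + y (1 - x y)^-1 x]; the formula is
    then verified algebraically. *)
Lemma invertible_swap t x y : t != 0 ->
  invertible (sc A t - x * y) -> invertible (sc A t - y * x).
Proof.
move=> t0 [z [h1 h2]].
exists (sc A t^-1 * (1 + y * z * x)); split.
- have -> : (sc A t - y * x) * (sc A t^-1 * (1 + y * z * x)) =
    sc A t^-1 * (sc A t - y * x + y * ((sc A t - x * y) * z) * x) by nc_ring.
  by rewrite h1 mulr1 subrK -scM mulVf// sc1.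
- have -> : sc A t^-1 * (1 + y * z * x) * (sc A t - y * x) =
    sc A t^-1 * (sc A t - y * x + y * (z * (sc A t - x * y)) * x) by nc_ring.
  by rewrite h2 mulr1 subrK -scM mulVf// sc1.
Qed.

Lemma ppos_star a : ppos a -> ppos (star a).
Proof. by move=> [t ta]; exists t; rewrite -(star_sc A t) -starB nrm_star. Qed.

Lemma pposD a b : ppos a -> ppos b -> ppos (a + b).
Proof.
move=> [s sa] [t tb]; exists (s + t).
by rewrite scD opprD addrACA (le_lt_trans (nrmD _ _))// ltrD.
Qed.

Lemma ppos_sc t : 0 < t -> ppos (sc A t).
Proof. by move=> t0; exists t; rewrite subrr nrm0. Qed.

Lemma ppos_scM t a : 0 < t -> ppos a -> ppos (sc A t * a).
Proof.
move=> t0 [s sa]; exists (t * s).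
by rewrite scM -mulrBr nrm_sc gtr0_norm// ltr_pM2l.
Qed.

(** Half of the slack [t - |t - a|] is given away. Together with [ppos_near] this is the openness of
    the cone. *)
Lemma ppos_sub a : ppos a -> exists2 e : R, 0 < e & ppos (a - sc A e).
Proof.
move=> [t ta]; exists ((t - nrm (sc A t - a)) / 2).
  by rewrite divr_gt0// subr_gt0.
set e := _ / 2.
exists (t - e); rewrite scB opprB addrA subrK.
by rewrite ltrBrDr -ltrBrDl /e ltr_pdivrMr// ltr_pMr ?subr_gt0// ltr1n.
Qed.

Lemma ppos_near a b e : ppos (a - sc A e) -> nrm (a - b) < e -> ppos b.
Proof.
move=> [t ta] ab; exists (t + e).
have -> : sc A (t + e) - b = (sc A t - (a - sc A e)) + (a - b) by nc_ring.
by rewrite (le_lt_trans (nrmD _ _))// ltrD.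
Qed.

End Sylvester.

(** * Square roots and norm estimates replacing the order *)

Section SquareRoots.
Context (R : realType) (A : cstarAlgType R).
Implicit Types (a b c d h x y z : A) (r s t e : R).

(** Writing the root as [s - y] turns the equation into [y = (s^2 - a + y^2) / (2 s)]. The bound
    [r (2 s - r)] is what keeps the ball of radius [r] invariant, and on it the map contracts by
    [r / s]. *)
Lemma sqrt_exists a s r : 0 <= r < s ->
  nrm (sc A (s * s) - a) <= r * (s + s - r) ->
  exists2 c, c * c = a & nrm (sc A s - c) <= r.
Proof.
move=> /andP[r0 rs] ar; have s0 : 0 < s by rewrite (le_lt_trans r0).
have ss0 : 0 < s + s by rewrite addr_gt0.
have ssN0 : s + s != 0 by rewrite gt_eqF.
have ssV0 : 0 <= (s + s)^-1 by rewrite invr_ge0 ltW.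
pose U : set (realify A) := closed_ball_ (fun x : realify A => `|x|) 0 r.
have UE (x : realify A) : U x = (nrm x <= r) by rewrite /U /closed_ball_ /=
  sub0r normrN.
pose f (h : realify A) : realify A :=
  sc A (s + s)^-1 * (sc A (s * s) - a + (h : A) * h).
have [|||||y Uy yE] := @contraction_fixpoint R (realify A) U f ((s + s)^-1 * (r
  + r)).
- exact: closed_closed_ball_.
- by exists 0; rewrite UE nrm0.
- move=> x; rewrite !UE => xr; rewrite [leLHS]nrm_sc ger0_norm//.
  rewrite mulrC ler_pdivrMr// (le_trans (nrmD _ _))//.
  rewrite (@le_trans _ _ (r * (s + s - r) + r * r))//; last first.
    by rewrite -mulrDr subrK.
  by rewrite lerD// (le_trans (nrmM _ _))// ler_pM// nrm_ge0.
- rewrite mulr_ge0 ?addr_ge0//= mulrC ltr_pdivrMr// mul1r ltrD//.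
- move=> x y; rewrite !UE => xr yr.
  have -> : f x - f y = sc A (s + s)^-1 * ((x : A) * (x - y : A) + (x - y : A)
    * y).
    have key (p v u w : A) : v * (p + u * u) - v * (p + w * w) =
      v * (u * (u - w) + (u - w) * w) by nc_ring.
    exact: key.
  rewrite [leLHS]nrm_sc ger0_norm// -mulrA ler_wpM2l// (le_trans (nrmD _ _))//.
  rewrite (mulrDl r) lerD// (le_trans (nrmM _ _))//;
    first by rewrite ler_wpM2r ?nrm_ge0.
  by rewrite mulrC ler_wpM2r ?nrm_ge0.
move: Uy; rewrite UE; move: yE; rewrite /f; move: (y : A) => {}y yE yr.
exists (sc A s - y); last by rewrite opprB addrC subrK.
have {}yE : sc A (s + s) * y = sc A (s * s) - a + y * y by rewrite {1}yE scVK.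
have -> : (sc A s - y) * (sc A s - y) = sc A (s * s) + y * y - sc A (s + s) * y.
  by nc_ring.
by rewrite yE; nc_ring.
Qed.

Lemma ppos_sqrt_exists a : ppos a -> exists2 c, ppos c & c * c = a.
Proof.
move=> [t ta]; set q := nrm _ in ta; have q0 : 0 <= q by exact: nrm_ge0.
have t0 : 0 < t by rewrite (le_lt_trans q0).
(* With [r = s - w] the bound [r (2 s - r) = s^2 - w^2] equals [q] exactly, and [w > 0] gives
   [r < s], so the root is again in the cone. *)
pose s := Num.sqrt t; pose w := Num.sqrt (t - q).
have s2 : s * s = t by rewrite -expr2 sqr_sqrtr// ltW.
have w2 : w * w = t - q by rewrite -expr2 sqr_sqrtr// subr_ge0 ltW.
have w0 : 0 < w by rewrite sqrtr_gt0 subr_gt0.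
have ws : w <= s by rewrite ler_wsqrtr// lerBlDr lerDl.
have [||c ca cs] := @sqrt_exists a s (s - w).
- by rewrite subr_ge0 ws ltrBlDr ltrDl.
- have -> : (s - w) * (s + s - (s - w)) = s * s - w * w by ring.
  by rewrite s2 w2 -/q opprB addrC subrK.
exists c => //; exists s; rewrite (le_lt_trans cs)//.
by rewrite ltrBlDr ltrDl.
Qed.

Definition csqrt a : A := xget 0 [set c | ppos c /\ c * c = a].

Lemma csqrtP a : ppos a -> ppos (csqrt a) /\ csqrt a * csqrt a = a.
Proof.
move=> /ppos_sqrt_exists[c c0 ca].
by apply: (@xgetPex _ 0 [set c | ppos c /\ c * c = a]); exists c.
Qed.

Lemma ppos_csqrt a : ppos a -> ppos (csqrt a). Proof. by case/csqrtP. Qed.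
Lemma csqrtM a : ppos a -> csqrt a * csqrt a = a. Proof. by case/csqrtP. Qed.

(** The identity [c (c - d) + (c - d) d = c^2 - d^2] holds without commutation, so [c - d] lies in
    the kernel of a Sylvester operator. *)
Lemma ppos_square_inj c d : ppos c -> ppos d -> c * c = d * d -> c = d.
Proof.
move=> c0 d0 cd; apply/eqP; rewrite -subr_eq0; apply/eqP.
apply: (sylvester_inj c0 d0); rewrite mulr0 mul0r addr0.
have -> : c * (c - d) + (c - d) * d = c * c - d * d by nc_ring.
by rewrite cd subrr.
Qed.

Lemma csqrt_star a : ppos a -> star a = a -> star (csqrt a) = csqrt a.
Proof.
move=> a0 sa; apply: ppos_square_inj; [exact/ppos_star/ppos_csqrt|exact:
  ppos_csqrt|].
by rewrite -starMr csqrtM// sa.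
Qed.

(** With [c = csqrt a], both [z c] and [c z] solve [c h + h c = c z c + z a]; no approximation of
    the root by polynomials in [a] is involved. *)
Lemma csqrt_comm a z : ppos a -> z * a = a * z -> z * csqrt a = csqrt a * z.
Proof.
move=> a0 za; apply: (sylvester_inj (ppos_csqrt a0) (ppos_csqrt a0)).
rewrite -[in RHS]mulrA -[z * _ * _]mulrA csqrtM// za [in RHS]mulrA csqrtM//
  addrC.
by rewrite mulrA.
Qed.

Definition imag : A := ('i : R[i]) *: (1 : A).

Lemma imag_comm x : imag * x = x * imag.
Proof.
rewrite /imag -[LHS](@cscalerAl R A) -[RHS](@cscalerAr R A).
by congr (_ *: _); exact: (etrans (mul1r x) (esym (mulr1 x))).
Qed.

Lemma imag2 : imag * imag = - 1.
Proof.
rewrite {1}/imag -[LHS](@cscalerAl R A) [cmul _ _]mul1r /imag scalerA.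
by rewrite -expr2 sqr_i scaleN1r.
Qed.

Lemma star_imag : star imag = - imag.
Proof.
rewrite /imag starZ star1 -scaleNr; congr (_ *: _).
by apply/eqP; rewrite eq_complex /= oppr0 !eqxx.
Qed.

(** Stands in for [a^2 <= a^2 + b^2]: the normal element [z = a + i b] satisfies
    [star z * z = a^2 + b^2], and [a] is the mean of [z] and [star z], so [|a| <= |z|]. *)
Lemma nrm_le_sumsq a b : star a = a -> star b = b -> a * b = b * a ->
  nrm a ^+ 2 <= nrm (a * a + b * b).
Proof.
move=> sa sb ab; pose z := a + imag * b.
have sz : star z = a - imag * b.
  by rewrite /z starD starMr star_imag sa sb mulrN -imag_comm.
have -> : a * a + b * b = star z * z.
  rewrite sz /z; have -> : (a - imag * b) * (a + imag * b) =
    a * a - imag * b * imag * b + (a * imag * b - imag * (b * a)) by nc_ring.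
  have -> : a * imag * b = imag * (b * a) by rewrite -imag_comm -mulrA ab.
  rewrite subrr addr0; congr (_ + _).
  by rewrite -(mulrA imag b imag) -(imag_comm b) mulrA imag2 !mulNr mul1r opprK.
rewrite nrm_cstar ler_sqr ?nnegrE ?nrm_ge0//.
rewrite -(ler_pM2l (_ : 0 < (2 : R)))// -{1}[2 : R]ger0_norm// -nrm_sc.
have -> : sc A 2 * a = star z + z.
  by rewrite sz /z (_ : 2 = 1 + 1 :> R)//; nc_ring.
by rewrite (le_trans (nrmD _ _))// nrm_star -mulr2n mulr_natl.
Qed.

(** For [t > |c|^2] the root [d] of [t - c^2] exists and [d^2 + c^2 = t]. Then [nrm_le_sumsq] gives
    [|t - c^2| = |d|^2 <= t], and [e] makes the inequality strict. *)
Lemma ppos_square_add c e : star c = c -> 0 < e -> ppos (c * c + sc A e).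
Proof.
move=> sc_ e0; pose t := nrm c ^+ 2 + 1.
have t0 : 0 < t by rewrite ltr_wpDl// sqr_ge0.
have tc : ppos (sc A t - c * c).
  exists t; rewrite opprB addrC subrK (le_lt_trans (nrmM _ _))//.
  by rewrite -expr2 /t ltrDl.
pose d := csqrt (sc A t - c * c).
have sd : star d = d by apply: csqrt_star; rewrite // starB star_sc starMr sc_.
have cd : c * d = d * c by apply: csqrt_comm => //; nc_ring.
have dd : d * d = sc A t - c * c by exact: csqrtM.
have : nrm d ^+ 2 <= nrm (d * d + c * c) by apply: nrm_le_sumsq.
rewrite dd subrK -nrm_cstar sd dd => /le_trans/(_ (nrm_sc_le _ _)).
rewrite (ger0_norm (ltW t0)) => h; exists (t + e).
have -> : sc A (t + e) - (c * c + sc A e) = sc A t - c * c by nc_ring.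
by rewrite (le_lt_trans h)// ltrDl.
Qed.

(** With [t > |c^-1|^2] and [e] the root of [t - c^-2], one has [(c e)^2 = t c^2 - 1]. So [c^2] is a
    positive multiple of [(c e)^2 + 1], a case of [ppos_square_add]. *)
Lemma ppos_square c : star c = c -> invertible c -> ppos (c * c).
Proof.
move=> sc_ ic; pose b := inverse c.
have sb : star b = b by rewrite star_inverse// sc_.
pose t := nrm b ^+ 2 + 1.
have t0 : 0 < t by rewrite ltr_wpDl// sqr_ge0.
have tb : ppos (sc A t - b * b).
  exists t; rewrite opprB addrC subrK (le_lt_trans (nrmM _ _))//.
  by rewrite -expr2 /t ltrDl.
pose e := csqrt (sc A t - b * b).
have se : star e = e by apply: csqrt_star; rewrite // starB star_sc starMr sb.
have cb : c * b = 1 by exact: mulxV.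
have bc : b * c = 1 by exact: mulVx.
have ce : c * e = e * c.
  apply: csqrt_comm => //; rewrite mulrBr mulrBl sc_comm; congr (_ - _).
  by rewrite mulrA cb mul1r -mulrA bc mulr1.
have cece : (c * e) * (c * e) = sc A t * (c * c) - 1.
  rewrite -[c * e * _]mulrA (mulrA e) -ce -(mulrA c e e) csqrtM//.
  rewrite (mulrBr c) (mulrA c b b) cb mul1r mulrBr cb; nc_ring.
have -> : c * c = sc A t^-1 * ((c * e) * (c * e) + sc A 1).
  by rewrite cece sc1 subrK scK// gt_eqF.
by apply: ppos_scM; rewrite ?invr_gt0//; apply: ppos_square_add;
  rewrite // starMr sc_ se.
Qed.

(** The roots [u], [v] of [e + x] and [e - x] commute with each other and with [x], and
    [x^2 + (u v)^2 = e^2]; hence [|x| <= e] by [nrm_le_sumsq]. *)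
Lemma ppos_both0 x : star x = x -> (forall e, 0 < e -> ppos (sc A e + x)) ->
  (forall e, 0 < e -> ppos (sc A e - x)) -> x = 0.
Proof.
move=> sx xp xn; apply: nrm_eq0; apply/eqP; rewrite eq_le nrm_ge0 andbT.
apply/ler_addgt0Pl => e e0; rewrite addr0 -ler_sqr ?nnegrE ?nrm_ge0 ?(ltW e0)//.
have {}xp := xp e e0; have {}xn := xn e e0.
pose u := csqrt (sc A e + x); pose v := csqrt (sc A e - x).
have su : star u = u by apply: csqrt_star; rewrite // starD star_sc sx.
have sv : star v = v by apply: csqrt_star; rewrite // starB star_sc sx.
have xu : x * u = u * x by apply: csqrt_comm => //; nc_ring.
have xv : x * v = v * x by apply: csqrt_comm => //; nc_ring.
have uv : u * v = v * u.
  by apply: csqrt_comm => //; rewrite mulrBr mulrBl sc_comm xu.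
have h : nrm x ^+ 2 <= nrm (x * x + (u * v) * (u * v)).
  apply: nrm_le_sumsq => //; first by rewrite starMr su sv uv.
  by rewrite mulrA xu -mulrA xv mulrA.
rewrite (le_trans h)//.
have -> : (u * v) * (u * v) = (u * u) * (v * v).
  by rewrite -mulrA (mulrA v) -uv -(mulrA u v v) mulrA.
rewrite !csqrtM//.
have -> : x * x + (sc A e + x) * (sc A e - x) = sc A (e * e) by nc_ring.
by rewrite (le_trans (nrm_sc_le _ _))// expr2 ger0_norm// mulr_ge0// ltW.
Qed.

(** [k], the root of [r^2], plays the absolute value of [r]. As [k - e] is in the cone for some
    [e > 0], so is [k + r = (k - e) + (r + e)], and [(k - r) (k + r) = 0] forces [r = k]. *)
Lemma ppos_of_limit (r : A) : star r = r -> invertible r ->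
  (forall e, 0 < e -> ppos (r + sc A e)) -> ppos r.
Proof.
move=> sr ir re; have rr := ppos_square sr ir; pose k := csqrt (r * r).
have k0 : ppos k by exact: ppos_csqrt.
have rk : r * k = k * r by apply: csqrt_comm => //; rewrite mulrA.
have [e e0 ke] := ppos_sub k0.
have kr : ppos (k + r).
  have -> : k + r = (k - sc A e) + (r + sc A e) by nc_ring.
  by apply: pposD => //; exact: re.
suff -> : r = k by [].
apply/eqP; rewrite eq_sym -subr_eq0; apply/eqP.
rewrite -[LHS]mulr1 -(mulxV (ppos_invertible kr)) mulrA.
have -> : (k - r) * (k + r) = k * k - r * r + (k * r - r * k) by nc_ring.
by rewrite csqrtM// rk !subrr addr0 mul0r.
Qed.

Lemma ppos_le a s t : s <= t -> ppos (a + sc A s) -> ppos (a + sc A t).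
Proof.
rewrite le_eqVlt => /orP[/eqP->//|st as_].
have -> : a + sc A t = (a + sc A s) + sc A (t - s) by nc_ring.
by apply: pposD => //; apply: ppos_sc; rewrite subr_gt0.
Qed.

(** A continuity argument on [t >= 0]: the [t] with [r + t] in the cone form an upward closed set.
    It contains its infimum by [ppos_of_limit], and since the cone is open a positive infimum could
    still be lowered. *)
Lemma ppos_of_resolvent (r : A) : star r = r ->
  (forall t : R, 0 <= t -> invertible (r + sc A t)) -> ppos r.
Proof.
move=> sr ir; pose T := [set t : R | 0 <= t /\ ppos (r + sc A t)].
have T0 : T (nrm r + 1).
  split; first by rewrite addr_ge0 ?nrm_ge0.
  exists (nrm r + 1); rewrite opprD addrCA subrr addr0 nrmN ltrDl//.
have lT : lbound T 0 by move=> t [].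
have hT : has_inf T by split; [exists (nrm r + 1)|exists 0].
pose t0 := inf T; have t00 : 0 <= t0 by apply: lb_le_inf => //;
  exists (nrm r + 1).
have p0 : ppos (r + sc A t0).
  apply: ppos_of_limit; [by rewrite starD star_sc sr|exact: ir|move=> e e0].
  have [t [_ pt] tt0] := inf_adherent e0 hT.
  by rewrite -addrA -scD; apply: ppos_le pt; exact: ltW.
have [t0E|t0N] := eqVneq t0 0; first by move: p0; rewrite t0E sc0 addr0.
have [e e0] := ppos_sub p0; rewrite -addrA -scB => pe.
have t0p : 0 < t0 by rewrite lt_neqAle eq_sym t0N.
have Tm : T (t0 - Num.min e t0).
  split; first by rewrite subr_ge0 ge_min lexx orbT.
  by apply: ppos_le pe; rewrite lerD2l lerN2 ge_min lexx.
have := ge_inf hT.2 Tm; rewrite -/t0 lerBrDr gerDl leNgt lt_min e0 t0p //.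
Qed.

End SquareRoots.

(** * Positivity and polar decomposition *)

Section PolarDecomposition.
Context (R : realType) (A : cstarAlgType R).
Implicit Types (a b c d h u w x y z : A) (s t e : R).

Lemma positive_ppos x : positive x -> invertible x -> ppos x.
Proof.
move=> [sx spx] ix; apply: ppos_of_resolvent => // t.
rewrite le_eqVlt => /orP[/eqP <-|t0]; first by rewrite sc0 addr0.
apply: contrapT => nit.
have : spectrum x (- t%:C) by rewrite /spectrum /= scaleNr opprK.
by move/spx; rewrite oppr_ge0 lecR leNgt t0.
Qed.

(** A non-real [a + i b] is excluded because [x - a - i b] is a commuting factor of
    [(x - a)^2 + b^2], which [ppos_square_add] makes invertible; a negative real is excluded by the
    cone being closed under sums. *)
Lemma ppos_positive x : star x = x -> ppos x -> positive x.
Proof.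
move=> sx px; split=> // -[a b] nix.
have nixE : ~ invertible (x - sc A a - imag A * sc A b).
  have lE : (a +i* b)%C *: (1 : A) = sc A a + imag A * sc A b.
    rewrite -sc_comm scE /imag scalerA /sc -scalerDl; congr (_ *: _).
    by apply/eqP; rewrite eq_complex /= !(mul0r, mulr0, mulr1, subr0, addr0,
      add0r) !eqxx.
  by move: nix; rewrite /spectrum /= lE opprD addrA.
have [b0|b0] := eqVneq b 0.
  rewrite b0 lecR leNgt; apply/negP => a0; apply: nixE.
  rewrite b0 sc0 mulr0 subr0 -scN; apply: ppos_invertible.
  by apply: pposD => //; apply: ppos_sc; rewrite oppr_gt0.
case: nixE; set p := x - _; set q := imag A * _.
have pq : p * q = q * p.
  by rewrite /q mulrA -imag_comm -!mulrA sc_comm.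
apply: (@invertible_comm_factor _ _ _ (p + q)).
  have -> : (p + q) * (p - q) =
    (p - q) * (p + q) + ((q * p - p * q) + (q * p - p * q)) by nc_ring.
  by rewrite pq subrr !addr0.
have -> : (p - q) * (p + q) = p * p - q * q + (p * q - q * p) by nc_ring.
have -> : q * q = - sc A (b * b).
  rewrite /q -mulrA (mulrA (sc A b)) sc_comm -!mulrA mulrA imag2 -scM.
  by rewrite mulNr mul1r.
rewrite pq subrr addr0 opprK; apply: ppos_invertible; apply: ppos_square_add.
  by rewrite /p starB sx star_sc.
by rewrite -expr2 lt_neqAle eq_sym sqrf_eq0 b0 sqr_ge0.
Qed.

(* The positivity of [x x^*]: with [h = x x^*], [k = sqrt (h^2)] and
   [y = x^* (k - h)], one has [y^* y = h (k - h)^2 = - k (k - h)^2 <= 0], hence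
   [y y^* <= 0] by comparing resolvents, while [y^* y + y y^*] is a sum of
   squares; so [y = 0] and [h = k]. *)
Lemma ppos_mul_star x : invertible x -> ppos (x * star x).
Proof.
move=> ix; set h := x * star x.
have sh : star h = h by rewrite starMr starK.
have ih : invertible h by apply: invertibleM => //; exact: invertible_star.
have hh : ppos (h * h) by exact: ppos_square.
pose k := csqrt (h * h); have k0 : ppos k by exact: ppos_csqrt.
have sk : star k = k by apply: csqrt_star => //; rewrite starMr sh.
have hk : h * k = k * h by apply: csqrt_comm => //; rewrite mulrA.
have kk : k * k = h * h by exact: csqrtM.
pose q := k - h; have sq : star q = q by rewrite starB sk sh.
(* The root of [k] commutes with [q], so [k q^2] is the square of the self-adjoint [f q], the form
   that [ppos_square_add] accepts. *)
pose f := csqrt k; have ff : f * f = k by exact: csqrtM.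
have sf : star f = f by exact: csqrt_star.
have hf : h * f = f * h by exact: csqrt_comm.
have kf : k * f = f * k by exact: csqrt_comm.
have qf : q * f = f * q by rewrite mulrBl mulrBr kf hf.
pose y := star x * q.
have yy : star y * y = - ((f * q) * (f * q)).
  have -> : star y * y = q * h * q by rewrite starMr sq starK /h !mulrA.
  have -> : q * h = - (k * q) by rewrite mulrBl mulrBr opprB kk.
  by rewrite mulNr -(mulrA f q) (mulrA q f) qf !mulrA ff.
have yyn e : 0 < e -> ppos (sc A e - y * star y).
  move=> e0; apply: ppos_of_resolvent.
    by rewrite starB star_sc starMr starK.
  move=> t t0; rewrite addrAC -scD; apply: invertible_swap.
    by rewrite gt_eqF// ltr_wpDr.
  rewrite yy opprK addrC; apply/ppos_invertible/ppos_square_add.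
    by rewrite starMr sf sq.
  by rewrite ltr_wpDr.
have yyp e : 0 < e -> ppos (sc A e + y * star y).
  move=> e0.
  (* Real and imaginary parts of [y] up to factors: half of [a^2 + b^2] is
     [y * star y + star y * y], and adding [(f q)^2] cancels the second term. The number [e] is
     shared between the two groups of squares. *)
  pose a := y + star y; pose b := imag A * (y - star y).
  have sa : star a = a by rewrite starD starK addrC.
  have sb : star b = b.
    by rewrite starMr star_imag starB starK mulrN -imag_comm -mulrN opprB.
  have aabb : a * a + b * b = sc A (1 + 1) * (y * star y + star y * y).
    have -> : b * b = - ((y - star y) * (y - star y)).
      rewrite /b -mulrA (mulrA (y - _)) -(imag_comm (y - _)) -mulrA mulrA imag2.
      by rewrite mulNr mul1r.
    by rewrite /a; nc_ring.
  pose d := e / 2; have d0 : 0 < d by rewrite divr_gt0.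
  have -> : sc A e + y * star y =
     sc A (1 + 1)^-1 * ((a * a + sc A d) + (b * b + sc A d)) +
     ((f * q) * (f * q) + sc A d).
    have -> : a * a + sc A d + (b * b + sc A d) =
       sc A (1 + 1) * (y * star y + star y * y + sc A d).
      by rewrite (mulrDr (sc A (1 + 1))) -aabb; nc_ring.
    by rewrite scK ?gt_eqF ?ltr0n// yy [e]splitr -/d; nc_ring.
  apply: pposD; last by apply: ppos_square_add; rewrite // starMr sf sq.
  apply: ppos_scM; first by rewrite invr_gt0 addr_gt0.
  by apply: pposD; exact: ppos_square_add.
have yy0 : y * star y = 0 by apply: ppos_both0; rewrite // starMr starK.
have y0 : y = 0.
  apply: nrm_eq0; apply/eqP; rewrite -nrm_star -sqrf_eq0 -nrm_cstar starK yy0.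
  by rewrite nrm0.
suff -> : h = k by [].
apply/eqP; rewrite eq_sym -subr_eq0 -/q; apply/eqP.
by rewrite -[q]mul1r -(mulVx (invertible_star ix)) -mulrA -/y y0 mulr0.
Qed.

Lemma unitary_mul u w : unitary u -> unitary w -> unitary (u * w).
Proof.
move=> [su us] [sw ws]; split; rewrite starMr mulrA.
  by rewrite -(mulrA _ _ u) su mulr1.
by rewrite -(mulrA u) ws mulr1.
Qed.

Lemma unitary_star u : unitary u -> unitary (star u).
Proof. by move=> [su us]; split; rewrite starK. Qed.

Lemma unitary1 : unitary (1 : A).
Proof. by split; rewrite star1 mulr1. Qed.

Lemma unitary_invertible u : unitary u -> invertible u.
Proof. by move=> [su us]; exists (star u). Qed.

Definition polar_radius x := csqrt (x * star x).

Lemma polar_radius_star x : invertible x -> star (polar_radius x) =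
  polar_radius x.
Proof.
by move=> ix; apply: csqrt_star; [exact: ppos_mul_star|rewrite starMr starK].
Qed.

Lemma ppos_polar_radius x : invertible x -> ppos (polar_radius x).
Proof. by move=> ix; apply/ppos_csqrt/ppos_mul_star. Qed.

Lemma polar_unitary_unitary x : invertible x ->
  unitary (inverse (polar_radius x) * x).
Proof.
move=> ix; set r := polar_radius x.
have ir : invertible r by exact/ppos_invertible/ppos_polar_radius.
have sr : star r = r by exact: polar_radius_star.
have rr : r * r = x * star x by apply/csqrtM/ppos_mul_star.
have us : inverse r * x * star (inverse r * x) = 1.
  rewrite starMr star_inverse// sr mulrA -(mulrA _ x) -rr.
  by rewrite mulrA mulVx// mul1r mulxV.
have iu : invertible (inverse r * x).
  by apply: invertibleM => //; exists r; split; [exact: mulVx|exact: mulxV].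
split=> //; set u := inverse r * x in iu us *.
have -> : star u = inverse u by rewrite -[LHS]mul1r -(mulVx iu) -mulrA us mulr1.
exact: mulVx.
Qed.

(** Pins down the choice made by [polar_unitary]. A competing radius is spectrally positive and
    invertible, hence in the cone, and it has the same square [x * star x] as [r]. *)
Lemma polar_unitaryE x r u : unitary u -> star r = r -> ppos r -> x = r * u ->
  polar_unitary x = u.
Proof.
move=> uu sr pr xru; apply: xget_unique.
  by split=> //; exists r; split=> //; exact: ppos_positive.
move=> w [uw [p [pp xpw]]].
have ip : invertible p.
  have -> : p = x * star w by rewrite xpw -mulrA uw.2 mulr1.
  rewrite xru; apply: invertibleM; last exact/unitary_invertible/unitary_star.
  by apply: invertibleM; [exact: ppos_invertible|exact: unitary_invertible].
have pE : p = r.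
  apply: ppos_square_inj => //; first exact: positive_ppos.
  have : x * star x = x * star x by [].
  rewrite {1 2}xpw xru !starMr sr pp.1 !mulrA -!(mulrA _ _ (star _)).
  by rewrite uw.2 uu.2 !mulr1.
have ir := ppos_invertible pr.
by rewrite -[w]mul1r -(mulVx ir) -mulrA -{2}pE -xpw xru mulrA mulVx// mul1r.
Qed.

Lemma polar_unitary_inverse x : invertible x ->
  polar_unitary x = inverse (polar_radius x) * x.
Proof.
move=> ix; apply: (@polar_unitaryE x (polar_radius x)).
- exact: polar_unitary_unitary.
- exact: polar_radius_star.
- exact: ppos_polar_radius.
- by rewrite mulrA mulxV ?mul1r//; exact/ppos_invertible/ppos_polar_radius.
Qed.

End PolarDecomposition.

(** * Smoothness of inverses and square roots *)

Section SmoothAlgebra.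
Context (R : realType) (A : cstarAlgType R).
Notation RA := (realify A).
Implicit Types (E : normedModType R) (k : nat).

Lemma realify_scale (t : R) (x : RA) : t *: x = sc A t * (x : A) :> A.
Proof. by rewrite scE. Qed.

(** The product retyped on the real normed space. Ring identities below are proved over [A] as [key]
    facts and transferred by conversion. *)
Definition rmul (x y : RA) : RA := (x : A) * (y : A).

Lemma rmul_bilinear : bounded_bilinear rmul 1.
Proof.
split=> [y a u v|x a u v|x y]; last by rewrite mul1r; exact: nrmM.
- rewrite /rmul !realify_scale.
  have key (p q r : A) : (sc A a * p + q) * r = sc A a * (p * r) + q * r by
    nc_ring.
  exact: key.
- rewrite /rmul !realify_scale.
  have key (p q r : A) : r * (sc A a * p + q) = sc A a * (r * p) + r * q by
    nc_ring.
  exact: key.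
Qed.

Lemma CkM k E (U : set E) (f g : E -> RA) : open U -> Ck k U f -> Ck k U g ->
  Ck k U (fun x => rmul (f x) (g x)).
Proof. by move=> oU; exact: Ck_bilin rmul_bilinear. Qed.

Definition rstar (x : RA) : RA := star (x : A).

Lemma rstar_linear : linear rstar.
Proof.
move=> a x y; rewrite /rstar !realify_scale.
have key (p q : A) : star (sc A a * p + q) = sc A a * star p + star q.
  by rewrite starD starMr star_sc sc_comm.
exact: key.
Qed.

Lemma rstar_bound (x : RA) : `|rstar x| <= 1 * `|x|.
Proof. by rewrite mul1r [leLHS](nrm_star (x : A)). Qed.

Definition cstar_map : clinear RA RA := clin_of rstar_linear rstar_bound.

Lemma Ck_star k E (U : set E) (f : E -> RA) : open U -> Ck k U f ->
  Ck k U (fun x => rstar (f x)).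
Proof. exact: (@Ck_clin _ _ _ _ _ _ _ cstar_map). Qed.

Definition rinv (x : RA) : RA := inverse (x : A).

Definition units : set RA := [set x : RA | invertible (x : A)].
Definition pposs : set RA := [set x : RA | ppos (x : A)].

Lemma open_nrmP (U : set RA) : (forall x : A, U x ->
  exists2 e : R, 0 < e & forall y : A, nrm (x - y) < e -> U y) -> open U.
Proof.
move=> oU; rewrite openE => x /oU[e e0 xU]; apply/nbhs_ballP; exists e;
  first exact: e0.
by move=> y; rewrite -ball_normE => /xU.
Qed.

Lemma open_pposs : open pposs.
Proof.
apply: open_nrmP => x /ppos_sub[e e0 xe]; exists e => // y xy.
exact: ppos_near xe xy.
Qed.

(** Near [x], [y = x (1 - x^-1 (x - y))], and the second factor lies in the ball of radius [1] about
    [1], part of the cone. *)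
Lemma open_units : open units.
Proof.
apply: open_nrmP => x ux.
have N0 : 0 < nrm (inverse x) + 1 by rewrite ltr_wpDl ?nrm_ge0.
exists (nrm (inverse x) + 1)^-1; first by rewrite invr_gt0.
move=> y xy.
have p1 : ppos (1 - inverse x * (x - y)).
  exists 1; rewrite sc1 opprB addrC subrK (le_lt_trans (nrmM _ _))//.
  have [->|xy0] := eqVneq (nrm (x - y)) 0; first by rewrite mulr0.
  have {}xy0 : 0 < nrm (x - y) by rewrite lt_neqAle eq_sym xy0 nrm_ge0.
  rewrite (@lt_trans _ _ ((nrm (inverse x) + 1) * nrm (x - y)))//.
    by rewrite ltr_pM2r// ltrDl.
  by rewrite mulrC -ltr_pdivlMr// mul1r.
have -> : units y = invertible (x * (1 - inverse x * (x - y))).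
  by rewrite mulrBr mulr1 mulrA mulxV// mul1r opprB addrC subrK.
by apply: invertibleM => //; exact: ppos_invertible.
Qed.

Section Sandwich.
Variables p q : RA.

Lemma sandwich_linear : linear (fun h : RA => - rmul (rmul p h) q).
Proof.
move=> a x y; rewrite /rmul !realify_scale.
have key (u v w z : A) : - (w * (sc A a * u + v) * z) =
  sc A a * - (w * u * z) - w * v * z by nc_ring.
exact: key.
Qed.

Lemma sandwich_bound h : `|- rmul (rmul p h) q| <= (`|p| * `|q|) * `|h|.
Proof.
rewrite normrN (le_trans (nrmM _ _))// -mulrA (mulrC `|q|) mulrA.
by rewrite ler_wpM2r ?nrm_ge0//; exact: nrmM.
Qed.

(** At [p = x^-1] and [q = y^-1] its value on [y - x] is [y^-1 - x^-1]: the resolvent identity in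
    the form required by [Ck_resolvent]. *)
Definition sandwich : clinear RA RA := clin_of sandwich_linear sandwich_bound.

End Sandwich.

Lemma sandwich_bilinear : bounded_bilinear sandwich 1.
Proof.
split=> [y a u v|x a u v|p q].
- apply: clinear_eq => h; rewrite clinearDE clinearZE /= /rmul !realify_scale.
  have key (p q r s : A) : - ((sc A a * p + q) * s * r) =
    sc A a * - (p * s * r) - (q * s * r) by nc_ring.
  exact: key.
- apply: clinear_eq => h; rewrite clinearDE clinearZE /= /rmul !realify_scale.
  have key (p q r s : A) : - (r * s * (sc A a * p + q)) =
    sc A a * - (r * s * p) - (r * s * q) by nc_ring.
  exact: key.
- by rewrite mul1r; apply: clinear_norm_le;
  [rewrite mulr_ge0|exact: sandwich_bound].
Qed.

Lemma Ck_rinv k : Ck k units rinv.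
Proof.
apply: (@Ck_resolvent R k RA RA units rinv sandwich 1) open_units
  sandwich_bilinear _.
move=> x y ux uy.
have key (p q : A) : invertible p -> invertible q ->
    inverse q - inverse p = - (inverse p * (q - p) * inverse q).
  move=> ip iq; rewrite mulrBr mulVx// mulrBl mul1r opprB -mulrA mulxV//.
  by rewrite mulr1.
exact: key.
Qed.

Lemma Ck_inv k E (U : set E) (f : E -> RA) : open U -> Ck k U f ->
  (forall x, U x -> units (f x)) -> Ck k U (fun x => rinv (f x)).
Proof.
move=> oU Cf Uf; apply: (@Ck_comp R k E RA RA U units f rinv) => //.
  exact: open_units.
exact: Ck_rinv.
Qed.

End SmoothAlgebra.

(** * Smooth dependence of Sylvester solutions and of square roots *)

Section SmoothSqrt.
Context (R : realType) (A : cstarAlgType R).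
Notation RA := (realify A).
Implicit Types (E : normedModType R) (k : nat) (p : RA * RA).

Definition syl p (h : RA) : RA := rmul p.1 h + rmul h p.2.

Lemma syl_bilinear : bounded_bilinear syl 2.
Proof.
split=> [y a u v|x a u v|p h].
- rewrite /syl (_ : (a *: u + v).1 = a *: u.1 + v.1)//.
  rewrite (_ : (a *: u + v).2 = a *: u.2 + v.2)// /rmul !realify_scale.
  have key (c1 c2 c3 c4 h : A) :
    (sc A a * c1 + c2) * h + h * (sc A a * c3 + c4) =
    sc A a * (c1 * h + h * c3) + (c2 * h + h * c4) by nc_ring.
  exact: key.
- rewrite /syl /rmul !realify_scale.
  have key (c1 c2 h1 h2 : A) :
    c1 * (sc A a * h1 + h2) + (sc A a * h1 + h2) * c2 =
    sc A a * (c1 * h1 + h1 * c2) + (c1 * h2 + h2 * c2) by nc_ring.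
  exact: key.
- rewrite (le_trans (ler_normD _ _))// -mulrA mulr_natl mulr2n lerD//.
    rewrite (le_trans (nrmM _ _))// ler_wpM2r ?nrm_ge0//.
    by have := fst_bound p; rewrite mul1r.
  rewrite (le_trans (nrmM _ _))// mulrC ler_wpM2r ?nrm_ge0//.
  by have := snd_bound p; rewrite mul1r.
Qed.

Definition syl_map : clinear (RA * RA)%type (clinear RA RA) :=
  curry_bilin syl_bilinear.

Definition ppos_pairs : set (RA * RA) := [set p | ppos (p.1 : A) /\ ppos (p.2 :
  A)].

Lemma open_ppos_pairs : open ppos_pairs.
Proof.
have -> : ppos_pairs = (setT `&` (fun p => p.1) @^-1` @pposs R A) `&`
                       (fun p => p.2) @^-1` @pposs R A.
  by rewrite setTI.
apply: open_preimage_in; last by move=> x _; exact: cvg_snd.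
  apply: open_preimage_in; [exact: openT|exact: open_pposs|].
  by move=> x _; exact: cvg_fst.
exact: open_pposs.
Qed.

Definition syl_solve p (b : RA) : RA := xget 0 [set h | syl p h = b].

Lemma syl_inj p : ppos_pairs p -> injective (syl p).
Proof. by move=> [p1 p2] x y; exact: (@sylvester_inj R A p.1 p.2 x y p1 p2).
  Qed.

Lemma syl_solveK p b : ppos_pairs p -> syl p (syl_solve p b) = b.
Proof.
move=> [[s cs] [t dt]]; apply: (@xgetPex _ 0 [set h | syl p h = b]).
exact: (@sylvester_solve R A p.1 p.2 s t b (ltrD cs dt)).
Qed.

Lemma syl_clin p : linear (syl p). Proof. exact: (bbil_r syl_bilinear p). Qed.

Lemma syl_solve_clin p : ppos_pairs p -> clin (syl_solve p).
Proof.
move=> Vp; have [[s cs] [t dt]] := Vp.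
have s0 : 0 < s by rewrite (le_lt_trans _ cs) ?nrm_ge0.
have t0 : 0 < t by rewrite (le_lt_trans _ dt) ?nrm_ge0.
(* The gap of [sylvester_bound]; its inverse bounds the norm of the solution operator. *)
set g := s + t - (nrm (sc A s - p.1) + nrm (sc A t - p.2)).
have g0 : 0 < g by rewrite subr_gt0 ltrD.
apply: (@bounded_clin _ _ _ _ g^-1).
  move=> a x y; apply: (syl_inj Vp); rewrite syl_clin.
  by rewrite !syl_solveK.
move=> b; rewrite mulrC ler_pdivlMr// mulrC -{2}(syl_solveK b Vp).
exact: (sylvester_bound p.1 p.2 _ (ltW (addr_gt0 s0 t0))).
Qed.

Definition syl_inv p : clinear RA RA := insubd 0 (syl_solve p).

Lemma syl_invE p : ppos_pairs p -> syl_inv p = syl_solve p :> (RA -> RA).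
Proof.
by move=> Vp; rewrite /syl_inv; apply: (@insubdK (RA -> RA));
  exact: syl_solve_clin.
Qed.

Lemma syl_invK p b : ppos_pairs p -> syl p (syl_inv p b) = b.
Proof. by move=> Vp; rewrite syl_invE// syl_solveK. Qed.

Section Variation.
Variables P Q : clinear RA RA.

Lemma syl_variation_linear :
  linear (fun d => - clin_comp P (clin_comp (syl_map d) Q)).
Proof.
move=> a x y; apply: clinear_eq => h.
rewrite clinearDE clinearZE !clinearNE /=.
rewrite (bbil_l syl_bilinear (Q h) a x y) linearP.
by rewrite opprD scalerN.
Qed.

Lemma syl_variation_bound d :
  `|- clin_comp P (clin_comp (syl_map d) Q)| <= (`|syl_map| * `|P| * `|Q|) *
    `|d|.
Proof.
rewrite normrN (le_trans (clin_comp_norm _ _))//.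
rewrite (_ : _ * `|d| = `|P| * ((`|syl_map| * `|d|) * `|Q|)); last by ring.
rewrite ler_wpM2l// (le_trans (clin_comp_norm _ _))// ler_wpM2r//.
exact: le_clinear_norm.
Qed.

Definition syl_variation : clinear (RA * RA)%type (clinear RA RA) :=
  clin_of syl_variation_linear syl_variation_bound.

End Variation.

Lemma syl_variation_bilinear : bounded_bilinear syl_variation `|syl_map|.
Proof.
split=> [Q a P P'|P a Q Q'|P Q].
- apply: clinear_eq => d; apply: clinear_eq => h.
  change (- (a *: P (syl d (Q h)) + P' (syl d (Q h))) =
    a *: - P (syl d (Q h)) - P' (syl d (Q h))).
  by rewrite opprD scalerN.
- apply: clinear_eq => d; apply: clinear_eq => h.
  change (- P (syl d (a *: Q h + Q' h)) =
    a *: - P (syl d (Q h)) - P (syl d (Q' h))).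
  by rewrite syl_clin (clinearP P).1 opprD scalerN.
- by apply: clinear_norm_le; [rewrite !mulr_ge0|exact: syl_variation_bound].
Qed.

(** The resolvent identity one level up. The Sylvester operator [S_p] is linear in the pair [p], so
    [S_q^-1 - S_p^-1 = - S_p^-1 S_(q - p) S_q^-1], and [Ck_resolvent] applies in the space of
    operators. *)
Lemma Ck_syl_inv k : Ck k ppos_pairs syl_inv.
Proof.
apply: (@Ck_resolvent R k _ _ ppos_pairs syl_inv syl_variation `|syl_map|)
  open_ppos_pairs syl_variation_bilinear _.
move=> p q Vp Vq; apply: clinear_eq => h.
change (syl_inv q h - syl_inv p h =
  - syl_inv p (syl (q - p) (syl_inv q h))).
apply: (syl_inj Vp).
have sylB (u v : RA * RA) x : syl (u - v) x = syl u x - syl v x.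
  have := bbil_l syl_bilinear x (-1) v u.
  by rewrite /= !scaleN1r (addrC _ u) (addrC _ (syl u x)).
have sylBr u v : syl p (u - v) = syl p u - syl p v.
  have := bbil_r syl_bilinear p (-1) v u.
  by rewrite !scaleN1r (addrC _ u) (addrC _ (syl p u)).
have syl0 : syl p 0 = 0 by rewrite -[X in syl p X](subrr 0) sylBr subrr.
rewrite -[- syl_inv p (syl _ _)]sub0r !sylBr syl0 sub0r !syl_invK//.
by rewrite sylB (syl_invK _ Vq) opprB.
Qed.

Definition rsqrt (x : RA) : RA := csqrt (x : A).

(** Read backwards, the difference quotient of the root is the inverse Sylvester operator at the
    pair of roots, the kernel used by [Ck_bootstrap]. *)
Lemma rsqrt_sub x y : pposs x -> pposs y ->
  syl (rsqrt x, rsqrt y) (rsqrt y - rsqrt x) = y - x.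
Proof.
move=> px py; rewrite /syl /rmul /=.
have key (c d : A) : c * (d - c) + (d - c) * d = d * d - c * c by nc_ring.
by rewrite [LHS]key /rsqrt !csqrtM.
Qed.

Lemma rsqrt_pairs x y : @pposs R A x -> @pposs R A y ->
  ppos_pairs (rsqrt x, rsqrt y).
Proof. by move=> px py; split; exact: ppos_csqrt. Qed.

Lemma Ck_rsqrt k : Ck k (@pposs R A) rsqrt.
Proof.
apply: (@Ck_bootstrap R k RA RA (@pposs R A) ppos_pairs rsqrt syl_inv).
- exact: open_pposs.
- exact: open_ppos_pairs.
- exact: rsqrt_pairs.
- move=> x y px py; apply: (syl_inj (rsqrt_pairs px py)).
  by rewrite rsqrt_sub// syl_invK//; exact: rsqrt_pairs.
- move=> x px; have [s sx] := ppos_csqrt px.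
  (* The gap of the root of [x] alone: that of the root of [y] can only enlarge the lower bound, so
     the Lipschitz constant [g^-1] does not depend on [y]. *)
  set g := s - nrm (sc A s - csqrt (x : A)).
  have g0 : 0 < g by rewrite subr_gt0.
  apply: (@continuous_dist_le _ _ _ _ _ g^-1 (@pposs R A)).
  + by apply: open_nbhs_nbhs; split=> //; exact: open_pposs.
  + by rewrite invr_ge0 ltW.
  + move=> y py; have [t ty] := ppos_csqrt py.
    rewrite mulrC ler_pdivlMr// mulrC -(rsqrt_sub px py).
    have s0 : 0 < s by rewrite (le_lt_trans _ sx) ?nrm_ge0.
    have t0 : 0 < t by rewrite (le_lt_trans _ ty) ?nrm_ge0.
    apply: le_trans (sylvester_bound _ _ _ (ltW (addr_gt0 s0 t0))).
    rewrite ler_wpM2r// /g opprD addrACA lerDl subr_ge0 ltW//.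
- exact: Ck_syl_inv.
Qed.

Lemma Ck_sqrt k E (U : set E) (f : E -> RA) : open U -> Ck k U f ->
  (forall x, U x -> pposs (f x)) -> Ck k U (fun x => rsqrt (f x)).
Proof.
move=> oU Cf Uf; apply: (@Ck_comp R k E RA RA U (@pposs R A) f rsqrt) => //.
  exact: open_pposs.
exact: Ck_rsqrt.
Qed.

End SmoothSqrt.

(** * Manifolds embedded in normed spaces *)

Section EmbeddedManifolds.
Context (R : realType).

(* A chart [c] of [M] compatible with an injection [iota] of the points into a
   normed space [V]: its domain is traced by the open set [W], its coordinates
   extend to a smooth map on [W], and its inverse is a smooth map into [V]. *)
Definition embedded_chart (T : Type) (E V : normedModType R) (M : manifold T E)
    (iota : T -> V) (c : chart T E) :=
  exists (W : set V) (C : V -> E) (O : set E) (s : E -> V),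
    [/\ open W /\ open O, forall k, Ck k W C /\ Ck k O s,
        forall p, dom c p <-> points M p /\ W (iota p),
        forall p, dom c p ->
          [/\ C (iota p) = coord c p, O (coord c p) & s (coord c p) = iota p] &
        forall e, O e -> exists2 p, dom c p & coord c p = e].

Definition embedded (T : Type) (E V : normedModType R) (M : manifold T E)
    (iota : T -> V) :=
  [/\ injective iota, forall p, points M p -> exists2 c, atlas M c & dom c p &
      forall c, atlas M c -> embedded_chart M iota c].

Section Maps.
Context (T T' : Type) (E E' V V' : normedModType R).
Context (M : manifold T E) (N : manifold T' E').
Context (iota : T -> V) (iota' : T' -> V').
Hypothesis (Me : embedded M iota) (Ne : embedded N iota').

(** In charts the map is the composite of the smooth inverse chart [sc_], the ambient [F] and the
    extended coordinate [Cd]. Surjectivity of the charts identifies its domain with an open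
    preimage. *)
Lemma embedded_smooth_in_charts c d (W : set T) (W0 : set V) (F : V -> V')
    (f : T -> T') : atlas M c -> atlas N d ->
  open W0 -> (forall k, Ck k W0 F) ->
  (forall p, points M p -> (W p <-> W0 (iota p))) ->
  (forall p, points M p -> W p -> points N (f p) /\ F (iota p) = iota' (f p)) ->
  smooth_in_charts c d (W `&` dom c `&` f @^-1` dom d) f.
Proof.
move=> Mc Nd oW0 CF WW0 Ff.
have [_ _ /(_ c Mc)[Wc [Cc [Oc [sc_ [[oWc oOc] Cc_ domc ecc surjc]]]]]] := Me.
have [_ _ /(_ d Nd)[Wd [Cd [Od [sd [[oWd oOd] Cd_ domd ecd surjd]]]]]] := Ne.
pose G := W0 `&` F @^-1` Wd; pose O := Oc `&` sc_ @^-1` G.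
have oG : open G.
  by apply: open_preimage_in => // x; apply: (Ck_continuous (CF 0)).
have oO : open O.
  by apply: open_preimage_in => // x; apply: (Ck_continuous (Cc_ 0).2).
have OE : coord c @` (W `&` dom c `&` f @^-1` dom d) = O.
  apply/seteqP; split=> [_ [p [[Wp cp] dp] <-]|e [Oe [W0e Wde]]].
    have [Mp _] := (domc p).1 cp.
    have [_ Op sp] := ecc p cp; have [Np Fp] := Ff p Mp Wp.
    split=> //; rewrite /G /= sp; split; first exact/WW0.
    by rewrite /= Fp; have [] := (domd (f p)).1 dp.
  have [p cp pe] := surjc e Oe; exists p => //.
  have [Mp _] := (domc p).1 cp; have [_ _ sp] := ecc p cp.
  have Wp : W p by apply/WW0; rewrite // -sp pe.
  have [Np Fp] := Ff p Mp Wp.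
  by split=> //; apply/domd; rewrite -Fp -sp pe.
exists (Cd \o (F \o sc_)).
  rewrite OE; split=> // k.
  have CFs : Ck k O (F \o sc_).
    apply: (@Ck_comp R k E V V' O W0 sc_ F oO oW0 _ _ (CF k)).
      by move=> e [_ []].
    by apply: Ck_sub (Cc_ k).2 => e [].
  apply: (@Ck_comp R k E V' E' O Wd (F \o sc_) Cd oO oWd _ CFs (Cd_ k).1).
  by move=> e [_ []].
move=> p [[Wp cp] dp] /=.
have [Mp _] := (domc p).1 cp; have [_ Op sp] := ecc p cp.
have [Np Fp] := Ff p Mp Wp.
by rewrite sp Fp; have [] := ecd (f p) dp.
Qed.

Lemma embedded_smooth_map (W : set T) (W0 : set V) (F : V -> V') (f : T -> T') :
  open W0 -> (forall k, Ck k W0 F) ->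
  (forall p, W p <-> points M p /\ W0 (iota p)) ->
  (forall p, W p -> points N (f p) /\ F (iota p) = iota' (f p)) ->
  smooth_map M N W f.
Proof.
move=> oW0 CF WW0 Ff; split=> [p /Ff[]//|c d Mc Nd].
apply: (@embedded_smooth_in_charts c d W W0 F) => //.
- by move=> p Mp; split=> [/WW0[]//|W0p]; exact/WW0.
- by move=> p _ /Ff.
Qed.

Lemma embedded_open_in (W : set T) (W0 : set V) : open W0 ->
  (forall p, W p <-> points M p /\ W0 (iota p)) -> open_in M W.
Proof.
move=> oW0 WW0; split=> [p /WW0[]//|c Mc].
have [_ _ /(_ c Mc)[Wc [Cc [Oc [sc_ [[oWc oOc] Cc_ domc ecc surjc]]]]]] := Me.
have -> : coord c @` (W `&` dom c) = Oc `&` sc_ @^-1` W0.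
  apply/seteqP; split=> [_ [p [Wp cp] <-]|e [Oe W0e]].
    have [_ Op sp] := ecc p cp; split=> //=; rewrite sp.
    by have [] := (WW0 p).1 Wp.
  have [p cp pe] := surjc e Oe; exists p => //; split=> //.
  have [Mp _] := (domc p).1 cp; have [_ _ sp] := ecc p cp.
  by apply/WW0; rewrite -sp pe.
by apply: open_preimage_in => // x; apply: (Ck_continuous (Cc_ 0).2).
Qed.

Lemma embedded_prod :
  embedded (prod_manifold M N) (fun p => (iota p.1, iota' p.2)).
Proof.
have [iM cM eM] := Me; have [iN cN eN] := Ne; split.
- by move=> [p q] [p' q'] /= [/iM -> /iN ->].
- move=> [p q] [/= /cM[c Mc cp] /cN[d Nd dq]].
  by exists (Chart (dom c `*` dom d) (fun p => (coord c p.1, coord d p.2)));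
    [exists (c, d)|].
move=> _ [[c d] [/= Mc Nd] <-].
have [Wc [Cc [Oc [sc_ [[oWc oOc] Cc_ domc ecc surjc]]]]] := eM c Mc.
have [Wd [Cd [Od [sd [[oWd oOd] Cd_ domd ecd surjd]]]]] := eN d Nd.
have oprod (X Y : normedModType R) (P : set X) (Q : set Y) : open P -> open Q ->
    open (P `*` Q).
  move=> oP oQ; have -> : P `*` Q = (setT `&` fst @^-1` P) `&` snd @^-1` Q.
    by rewrite setTI.
  apply: open_preimage_in => //; last by move=> x _; exact: cvg_snd.
  apply: open_preimage_in => //; first exact: openT.
  by move=> x _; exact: cvg_fst.
have Cprod k (X Y X' Y' : normedModType R) (P : set X) (Q : set Y)
    (f : X -> X') (g : Y -> Y') : open P -> open Q -> Ck k P f -> Ck k Q g ->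
    Ck k (P `*` Q) (fun p => (f p.1, g p.2)).
  move=> oP oQ Cf Cg; have oPQ := oprod _ _ _ _ oP oQ.
  apply: (Ck_pair oPQ).
    apply: (@Ck_comp R k (X * Y)%type X X' (P `*` Q) P fst f oPQ oP _ _ Cf).
      by move=> x [].
    by apply: Ck_fst => //; exact: Ck_id.
  apply: (@Ck_comp R k (X * Y)%type Y Y' (P `*` Q) Q snd g oPQ oQ _ _ Cg).
    by move=> x [].
  by apply: Ck_snd => //; exact: Ck_id.
exists (Wc `*` Wd), (fun v => (Cc v.1, Cd v.2)), (Oc `*` Od),
  (fun e => (sc_ e.1, sd e.2)); split.
- by split; exact: oprod.
- by move=> k; split; apply: Cprod; rewrite ?(Cc_ k).1 ?(Cc_ k).2//;
    have [] := Cc_ k; have [] := Cd_ k.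
- move=> [p q] /=; split=> [[/= /domc[Mp Wp] /domd[Nq Wq]]//|].
  by move=> [[/= Mp Nq] [/= Wp Wq]]; split=> /=; [exact/domc|exact/domd].
- move=> [p q] [/= cp dq]; have [-> Op ->] := ecc p cp.
  by have [-> Oq ->] := ecd q dq.
- move=> [e e'] [/= /surjc[p cp <-] /surjd[q dq <-]].
  by exists (p, q).
Qed.

End Maps.

(** Compatibility of two charts is smoothness of the identity, whose ambient extension is the
    identity of [V]. *)
Lemma embedded_is_manifold (T : Type) (E V : normedModType R)
    (M : manifold T E) (iota : T -> V) : embedded M iota -> is_manifold M.
Proof.
move=> Me; have [iM cM eM] := Me; split.
- apply/seteqP; split=> [p /cM[c Mc cp]|p [c Mc cp]].
    by exists c.
  have [Wc [Cc [Oc [sc_ [_ _ dc _ _]]]]] := eM c Mc.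
  by have [] := (dc p).1 cp.
- move=> c /eM[Wc [Cc [Oc [sc_ [_ _ dc ec _]]]]] p q; rewrite !inE => cp cq pq.
  apply: iM; have [_ _ <-] := ec p cp; have [_ _ <-] := ec q cq.
  by rewrite pq.
- move=> c d Mc Md.
  have [W [_ [_ [_ [_ _ dc _ _]]]]] := eM c Mc.
  have -> : dom c `&` dom d = points M `&` dom c `&` id @^-1` dom d.
    apply/seteqP; split=> [p [cp dp]|p [[Mp cp] dp]]; last by split.
    by split=> //; split=> //; have [] := (dc p).1 cp.
  apply: (@embedded_smooth_in_charts _ _ _ _ _ _ _ _ _ _ Me Me c d
    (points M) setT id) => //; first exact: openT.
  by move=> k; apply: Ck_id; exact: openT.
Qed.

End EmbeddedManifolds.

Section ChartedManifold.
Context (R : realType) (T T' : Type) (E V V' : normedModType R).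

(* The counterpart of [embedded_chart] for a chart with values in a manifold
   [N] that is itself embedded in [V']. *)
Definition embedded_model_chart (M : set T) (N : manifold T' E) (iota : T -> V)
    (iota' : T' -> V') (D : set T) (psi : T -> T') :=
  exists (W : set V) (P : V -> V') (O : set V') (S : V' -> V),
    [/\ open W /\ open O, forall k, Ck k W P /\ Ck k O S,
        forall p, D p <-> M p /\ W (iota p),
        forall p, D p -> [/\ points N (psi p), P (iota p) = iota' (psi p),
          O (iota' (psi p)) & S (iota' (psi p)) = iota p] &
        forall q, points N q -> O (iota' q) -> exists2 p, D p & psi p = q].

Lemma embedded_charted (M : set T) (C : set (set T * (T -> T')))
    (N : manifold T' E) (iota : T -> V) (iota' : T' -> V') :
  injective iota -> embedded N iota' ->
  (forall p, M p -> exists2 d, C d & d.1 p) ->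
  (forall d, C d -> embedded_model_chart M N iota iota' d.1 d.2) ->
  embedded (charted_manifold M C N) iota.
Proof.
move=> iI [_ cN eN] covM eC; split=> //.
  move=> p /covM[d Cd dp].
  have [W [P [Om [sg [_ _ _ ec _]]]]] := eC d Cd.
  have [/cN[n Nn nq] _ _ _] := ec p dp.
  exists (Chart (d.1 `&` d.2 @^-1` dom n) (coord n \o d.2)) => //.
  by exists (d, n).
move=> _ [[[D psi] n] [/= Cd Nn] <-].
have [W [P [Om [sg [[oW oO'] CPS DW ec surj]]]]] := eC _ Cd.
have [Wn [Cn [On [Sn [[oWn oOn] CCS dn en surjn]]]]] := eN n Nn.
have oW1 : open (W `&` P @^-1` Wn).
  by apply: open_preimage_in => // x; apply: (Ck_continuous (CPS 0).1).
have oO1 : open (On `&` Sn @^-1` Om).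
  by apply: open_preimage_in => // x; apply: (Ck_continuous (CCS 0).2).
exists (W `&` P @^-1` Wn), (Cn \o P), (On `&` Sn @^-1` Om), (sg \o Sn);
  split=> //.
- move=> k; split.
    apply: (@Ck_comp R k V V' E _ Wn P Cn oW1 oWn _ _ (CCS k).1).
      by move=> x [].
    by apply: Ck_sub (CPS k).1 => x [].
  apply: (@Ck_comp R k E V' V _ Om Sn sg oO1 oO' _ _ (CPS k).2).
    by move=> x [].
  by apply: Ck_sub (CCS k).2 => x [].
- move=> p /=; split=> [[Dp np]|[Mp [Wp Pp]]].
    have [Mp Wp] := (DW p).1 Dp; have [_ Pp _ _] := ec p Dp.
    by split=> //; split=> //=; rewrite Pp; have [] := (dn _).1 np.
  have Dp : D p by apply/DW.
  split=> //; have [Np Pp' _ _] := ec p Dp.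
  by apply/dn; rewrite -Pp'.
- move=> p [/= Dp np]; have [Np Pp Op Sp] := ec p Dp.
  have [Cp Onp Snp] := en _ np.
  by rewrite Pp Cp Snp Sp; split=> //; split=> //=; rewrite Snp.
- move=> e [One /= Oe]; have [q nq qe] := surjn e One.
  have [Nq _] := (dn q).1 nq; have [_ _ Snq] := en q nq.
  have [|p Dp /= pq] := surj q Nq; first by rewrite -Snq qe.
  by exists p; [split=> //=; rewrite pq|rewrite /= pq].
Qed.

End ChartedManifold.

(** * The unitary group *)

Section CayleyTransform.
Context (R : realType) (A : cstarAlgType R).
Implicit Types (u v w x y z : A).

Definition cayley x : A := (1 - x) * inverse (1 + x).

(** Shows that [1 + cayley x] is again invertible, so the transform can be applied twice. *)
Lemma cayley_add1 x : invertible (1 + x) ->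
  1 + cayley x = sc A 2 * inverse (1 + x).
Proof.
move=> ix; rewrite -{1}(mulxV ix) -mulrDl.
by congr (_ * _); rewrite (_ : 2 = 1 + 1 :> R)//; nc_ring.
Qed.

Lemma is_inverse_sc t x y : t != 0 -> is_inverse x y ->
  is_inverse (sc A t * x) (sc A t^-1 * y).
Proof.
move=> t0 [xy yx]; split.
  by rewrite -mulrA (mulrA x) -sc_comm -mulrA xy mulr1 -scM mulfV// sc1.
by rewrite -mulrA (mulrA y) -sc_comm -mulrA yx mulr1 -scM mulVf// sc1.
Qed.

Lemma is_inverse_cayley_add1 x : invertible (1 + x) ->
  is_inverse (1 + cayley x) (sc A 2^-1 * (1 + x)).
Proof.
move=> ix; rewrite cayley_add1//; apply: is_inverse_sc; first by rewrite gt_eqF.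
by split; [exact: mulVx|exact: mulxV].
Qed.

Lemma cayleyK x : invertible (1 + x) -> cayley (cayley x) = x.
Proof.
move=> ix; rewrite {1}/cayley (is_inverseE (is_inverse_cayley_add1 ix)).
have -> : 1 - cayley x = sc A 2 * x * inverse (1 + x).
  rewrite -{1}(mulxV ix) -mulrBl.
  by congr (_ * _); rewrite (_ : 2 = 1 + 1 :> R)//; nc_ring.
set i := inverse _; have -> : sc A 2 * x * i * (sc A 2^-1 * (1 + x)) =
  sc A 2 * (sc A 2^-1 * (x * (i * (1 + x)))) by nc_ring.
by rewrite mulVx// mulr1 scVK.
Qed.

(** [i x] is self-adjoint and [(1 + x) (1 - x) = (i x)^2 + 1], with commuting factors. *)
Lemma skew_add1_invertible x : star x = - x -> invertible (1 + x).
Proof.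
move=> sx; apply: (@invertible_comm_factor _ _ _ (1 - x)); first by nc_ring.
have -> : (1 + x) * (1 - x) = (imag A * x) * (imag A * x) + sc A 1.
  have -> : imag A * x * (imag A * x) = - (x * x).
    by rewrite -mulrA (mulrA x) -(imag_comm x) !mulrA imag2 !mulNr mul1r.
  by nc_ring.
apply/ppos_invertible/ppos_square_add => //.
by rewrite starMr star_imag sx mulrN mulNr opprK -imag_comm.
Qed.

Lemma star_cayley x : invertible (1 + x) ->
  star (cayley x) = inverse (1 + star x) * (1 - star x).
Proof.
by move=> ix; rewrite starMr star_inverse// starD starB star1.
Qed.

Lemma cayley_comm x y : invertible (1 + x) -> x * y = y * x ->
  inverse (1 + x) * y = y * inverse (1 + x).
Proof.
by move=> ix xy; apply: commute_inverse => //;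
  rewrite mulrDl mulrDr xy mul1r mulr1.
Qed.

Lemma skew_cayley z : unitary z -> invertible (1 + z) ->
  star (cayley z) = - cayley z.
Proof.
move=> [sz zs] iz; rewrite star_cayley//.
(* From [1 + star z = star z * (1 + z)] and [star z = z^-1]. *)
have -> : inverse (1 + star z) = inverse (1 + z) * z.
  apply: is_inverseE; have [h1 h2] := inverseP iz.
  have zE : 1 + star z = star z * (1 + z) by rewrite mulrDr sz mulr1 addrC.
  split; first by rewrite zE -mulrA (mulrA _ _ z) h1 mul1r.
  rewrite -mulrA (_ : z * _ = 1 + z) ?h2//.
  by rewrite mulrDr zs mulr1 addrC.
rewrite -mulrA mulrBr zs mulr1 -[z - 1]opprB mulrN; congr (- _).
by apply: cayley_comm => //; nc_ring.
Qed.

Lemma unitary_cayley x : star x = - x -> unitary (cayley x).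
Proof.
move=> sx; have ip := skew_add1_invertible sx.
have im : invertible (1 - x) by have := invertible_star ip;
  rewrite starD star1 sx.
have c : (1 - x) * inverse (1 + x) = inverse (1 + x) * (1 - x).
  by rewrite cayley_comm//; nc_ring.
have sc_ : star (cayley x) = inverse (1 - x) * (1 + x).
  by rewrite star_cayley// sx opprK.
split; rewrite sc_ /cayley.
  rewrite c -mulrA (mulrA (1 + x)) mulxV// mul1r mulVx//.
by rewrite c -mulrA (mulrA (1 - x)) mulxV// mul1r mulVx.
Qed.

End CayleyTransform.

Section UnitaryGroupEmbedding.
Context (R : realType) (A : cstarAlgType R).
Notation RA := (realify A).
Notation SA := (skew_adjoint A).

Lemma skew_valP (s : SA) : star (skew_val s : A) = - (skew_val s : A).
Proof. by case: s => x /= /eqP. Qed.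

Lemma skew_val_linear : linear (@skew_val R A). Proof. by []. Qed.

Lemma skew_val_bound (s : SA) : `|skew_val s| <= 1 * `|s|.
Proof. by rewrite mul1r. Qed.

Definition cskew_val : clinear SA RA := clin_of skew_val_linear skew_val_bound.

Fact skew_part_subproof (x : RA) : @Defs.skew R A (2^-1 *: (x - rstar x) : RA).
Proof.
rewrite /Defs.skew realify_scale; apply/eqP.
have key (y : A) : star (sc A 2^-1 * (y - star y)) = - (sc A 2^-1 * (y - star
  y)).
  by rewrite starMr star_sc starB starK -sc_comm -mulrN opprB.
exact: key.
Qed.

(** A bounded projection onto the skew-adjoint elements. It replaces [insubd] in the ambient
    extension of a Cayley chart, whose formula takes values that are not skew-adjoint away from the
    unitaries. *)
Definition skew_part (x : RA) : SA := SkewAdjoint (skew_part_subproof x).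

Lemma skew_part_linear : linear skew_part.
Proof.
move=> a x y; apply: val_inj.
rewrite [LHS]/= [RHS]/= rstar_linear opprD addrACA -scalerBr scalerDr.
by rewrite !scalerA mulrC.
Qed.

Lemma skew_part_bound (x : RA) : `|skew_part x| <= 1 * `|x|.
Proof.
change (`|2^-1 *: (x - rstar x) : RA| <= 1 * `|x|).
rewrite normrZ gtr0_norm// ler_pdivrMl// mul1r.
rewrite (le_trans (ler_normB _ _))// mulr_natl mulr2n lerD2l.
by have := rstar_bound x; rewrite mul1r.
Qed.

Definition cskew_part : clinear RA SA := clin_of skew_part_linear
  skew_part_bound.

Lemma skew_partE (x : A) : star x = - x -> skew_part x = insubd (0 : SA) (x :
  RA).
Proof.
move=> sx; apply: val_inj; rewrite insubdK; last by rewrite unfold_in;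
  exact/eqP.
change (2^-1 *: ((x : RA) - rstar x) = x).
rewrite realify_scale.
have key : sc A 2^-1 * (x - star x) = x.
  rewrite sx opprK; have -> : sc A 2^-1 * (x + x) = sc A (2^-1 + 2^-1) * x.
    by nc_ring.
  by rewrite (_ : _ + _ = 1) ?sc1 ?mul1r//; lra.
exact: key.
Qed.

Lemma embedded_alg_manifold :
  embedded (alg_manifold A) (fun a : A => a : RA).
Proof.
split=> //; first by move=> a _; exists (Chart setT (fun a : A => a : RA)).
move=> _ ->; exists setT, (fun x => x), setT, (fun x => x); split=> //.
- by split; exact: openT.
- by move=> k; split; apply: Ck_id; exact: openT.
- by move=> e _; exists e.
Qed.

Lemma embedded_unitary_group :
  embedded (unitary_group A) (fun a : A => a : RA).
Proof.
have one_add (u : A) : unitary u -> star u * u = 1 by case.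
split=> //.
  move=> u uu; exists (cayley_chart u); first by exists u.
  split=> //; rewrite one_add//; apply: ppos_invertible.
  by rewrite -(sc1 A); apply: pposD; exact: ppos_sc.
move=> _ [v uv <-].
pose W : set RA := [set w : RA | invertible (1 + star v * (w : A))].
pose Z (w : RA) : RA := rmul (star v : A) w.
pose C (w : RA) : SA :=
  cskew_part (rmul ((1 : A) - Z w) (rinv ((1 : A) + Z w))).
pose S (s : SA) : RA :=
  rmul (v : RA) (rmul ((1 : A) - cskew_val s) (rinv ((1 : A) + cskew_val s))).
have CZ k U : open U -> Ck k U Z.
  by move=> oU; apply: CkM => //; [exact: Ck_cst|exact: Ck_id].
have oW : open W.
  have -> : W = setT `&` (fun w => ((1 : A) : RA) + Z w) @^-1` @units R A.
    by rewrite setTI.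
  apply: open_preimage_in; [exact: openT|exact: open_units|move=> x _].
  apply: (@Ck_continuous _ 0 _ _ setT) => //.
  by apply: CkD; [exact: openT|apply: Ck_cst; exact: openT|apply: CZ;
    exact: openT].
have vv (x : A) : v * (star v * x) = x by rewrite mulrA uv.2 mul1r.
have vv' (x : A) : star v * (v * x) = x by rewrite mulrA uv.1 mul1r.
have unz (w : A) : unitary w -> unitary (star v * w).
  by move=> uw; apply: unitary_mul => //; exact: unitary_star.
have SE (s : SA) : S s = v * cayley (skew_val s : A) by [].
exists W, C, setT, S; split.
- by split; [exact: oW|exact: openT].
- move=> k; split.
    apply: Ck_clin => //; apply: CkM => //.
      by apply: CkB => //; [exact: Ck_cst|exact: CZ].
    apply: Ck_inv => //; apply: CkD => //; first exact: Ck_cst.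
    exact: CZ.
  have oT : open (setT : set SA) by exact: openT.
  have Cv : Ck k setT cskew_val by exact: Ck_clinear.
  apply: CkM => //; first exact: Ck_cst.
  apply: CkM => //; first by apply: CkB => //; exact: Ck_cst.
  apply: Ck_inv => //; first by apply: CkD => //; exact: Ck_cst.
  by move=> s _; apply: skew_add1_invertible; exact: skew_valP.
- by move=> w.
- move=> w [uw iw]; have uz := unz w uw.
  have sz := skew_cayley uz iw.
  split=> //; first exact: (skew_partE sz).
  rewrite SE /= -(skew_partE sz).
  have -> : (skew_val (skew_part (cayley (star v * w) : A)) : A) =
      cayley (star v * w).
    by rewrite (skew_partE sz) insubdK// unfold_in; exact/eqP.
  by rewrite cayleyK// vv.
- move=> s _; exists (S s).
    split; first by rewrite SE; apply: unitary_mul => //;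
      exact/unitary_cayley/skew_valP.
    rewrite SE vv'; eexists; apply: is_inverse_cayley_add1.
    exact/skew_add1_invertible/skew_valP.
  change (insubd (0 : SA) (cayley (star v * S s) : RA) = s).
  rewrite SE vv' cayleyK; last exact/skew_add1_invertible/skew_valP.
  exact: valKd.
Qed.

End UnitaryGroupEmbedding.

Section UnitaryLieGroup.
Context (R : realType) (A : cstarAlgType R).
Notation RA := (realify A).

Lemma unitary_group_lie : is_lie_group (unitary_group A) *%R 1 (@star R A).
Proof.
have eU := @embedded_unitary_group R A.
have oT (X : normedModType R) : open (setT : set X) by exact: openT.
split.
- exact: embedded_is_manifold eU.
- split=> [|u v uu vv|u uu]; first exact: unitary1.
    exact: unitary_mul.
  exact: unitary_star.
- split=> [u v w _ _ _|u _|u [su us]] //; first exact: mulrA.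
  by rewrite mul1r mulr1.
- apply: (@embedded_smooth_map _ _ _ _ _ _ _ _ _ _ _ (embedded_prod eU eU) eU
    (points (unitary_group A) `*` points (unitary_group A)) setT
    (fun p : RA * RA => rmul p.1 p.2)) => //.
  + by move=> k; apply: CkM => //; [apply: Ck_fst|apply: Ck_snd] => //;
    exact: Ck_id.
  + by move=> p; split=> // -[].
  + by move=> [u v] [/= uu vv]; split=> //; exact: unitary_mul.
- apply: (@embedded_smooth_map _ _ _ _ _ _ _ _ _ _ _ eU eU
    (points (unitary_group A)) setT (@rstar R A)) => //.
  + by move=> k; apply: Ck_star => //; exact: Ck_id.
  + by move=> p; split=> // -[].
  + by move=> u uu; split=> //; exact: unitary_star.
Qed.

End UnitaryLieGroup.

(** * The unitary sphere and the Riemann sphere *)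

Section TwoByTwo.
Context (R : realType) (A : cstarAlgType R).
Implicit Types (U X Y : 'M[A]_2) (x y : 'cV[A]_2) (a u : A).

Lemma mulmx2E m n (X : 'M[A]_(m, 2)) (Y : 'M[A]_(2, n)) i j :
  (X *m Y) i j = X i 0 * Y 0 j + X i 1 * Y 1 j.
Proof.
by rewrite mxE big_ord_recl big_ord_recl big_ord0 addr0;
  congr (_ + X _ _ * Y _ _);
  exact: val_inj.
Qed.

Lemma mulmx1E m n (X : 'M[A]_(m, 1)) (Y : 'M[A]_(1, n)) i j :
  (X *m Y) i j = X i 0 * Y 0 j.
Proof. by rewrite mxE big_ord_recl big_ord0 addr0. Qed.

Lemma adjE m n (X : 'M[A]_(m, n)) i j : adj X i j = star (X j i).
Proof. by rewrite !mxE. Qed.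

Lemma star_sum I (r : seq I) (F : I -> A) :
  star (\sum_(i <- r) F i) = \sum_(i <- r) star (F i).
Proof. by apply: (big_morph _ (@starD R A)); exact: star0. Qed.

Lemma adjM m n p (X : 'M[A]_(m, n)) (Y : 'M[A]_(n, p)) :
  adj (X *m Y) = adj Y *m adj X.
Proof.
apply/matrixP => i j; rewrite adjE !mxE star_sum; apply: eq_bigr => k _.
by rewrite starMr !adjE.
Qed.

Lemma adjK m n (X : 'M[A]_(m, n)) : adj (adj X) = X.
Proof. by apply/matrixP => i j; rewrite !adjE starK. Qed.

Lemma ord2P (i : 'I_2) : i = 0 \/ i = 1.
Proof. by case: i => -[|[|//]] ?; [left|right]; exact: val_inj. Qed.

Lemma mx2P X Y : X 0 0 = Y 0 0 -> X 0 1 = Y 0 1 -> X 1 0 = Y 1 0 ->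
  X 1 1 = Y 1 1 -> X = Y.
Proof.
move=> h00 h01 h10 h11; apply/matrixP => i j.
by have [->|->] := ord2P i; have [->|->] := ord2P j.
Qed.

Lemma cV2P x y : x 0 0 = y 0 0 -> x 1 0 = y 1 0 -> x = y.
Proof.
by move=> h0 h1; apply/colP => i; have [->|->] := ord2P i.
Qed.

Definition col2 a b : 'cV[A]_2 := \col_i (if i == 0 then a else b).

Definition mx22 a b c d : 'M[A]_2 :=
  \matrix_(i, j) (if i == 0 then (if j == 0 then a else b)
                  else (if j == 0 then c else d)).

Lemma unitary_mx_adj U : unitary_mx U -> unitary_mx (adj U).
Proof. by move=> [h1 h2]; split; rewrite adjK. Qed.

Lemma unitary_mxM U X : unitary_mx U -> unitary_mx X -> unitary_mx (U *m X).
Proof.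
move=> [u1 u2] [x1 x2]; split; rewrite adjM mulmxA.
  by rewrite -(mulmxA (adj X)) u1 mulmx1.
by rewrite -(mulmxA U) x2 mulmx1.
Qed.

Lemma unitary_mx1 : unitary_mx (1%:M : 'M[A]_2).
Proof.
have a1 : adj (1%:M : 'M[A]_2) = 1%:M.
  apply/matrixP => i j; rewrite adjE !mxE eq_sym.
  by case: (i == j); rewrite ?star1 ?star0.
by split; rewrite a1 mulmx1.
Qed.

Lemma sphere_mul U x : unitary_mx U -> sphere x -> sphere (U *m x).
Proof.
move=> uU [X uX <-]; exists (U *m X); first exact: unitary_mxM.
by rewrite mulmxA.
Qed.

Lemma sphere_norm x : sphere x -> adj x *m x = 1%:M.
Proof.
move=> [U [uU _] <-]; rewrite adjM mulmxA -(mulmxA (adj _)) uU mulmx1.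
apply/matrixP => i j; rewrite !ord1 mulmx2E !adjE !mxE /=.
by rewrite star1 star0 mulr1 mul0r addr0.
Qed.

Lemma sphere_normE x : sphere x ->
  star (x 0 0) * x 0 0 + star (x 1 0) * x 1 0 = 1.
Proof.
by move/sphere_norm/matrixP/(_ 0 0); rewrite mulmx2E !adjE mxE.
Qed.

Lemma sphere_e1 : sphere (e1 A).
Proof. by exists 1%:M; [exact: unitary_mx1|rewrite mul1mx]. Qed.

Lemma right_mulE x u : right_mul x u = x *m u%:M.
Proof. by apply/colP => i; rewrite mulmx1E !mxE eqxx. Qed.

Lemma right_mulM U x u : right_mul (U *m x) u = U *m right_mul x u.
Proof. by rewrite !right_mulE mulmxA. Qed.

(** On [e1], right multiplication by [u] is left multiplication by the unitary matrix
    [diag(u, 1)]. *)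
Lemma sphere_right_mul x u : sphere x -> unitary u -> sphere (right_mul x u).
Proof.
move=> [U uU <-] [su us].
rewrite right_mulM; apply: sphere_mul => //.
have -> : right_mul (e1 A) u = mx22 u 0 0 1 *m e1 A.
  by apply: cV2P; rewrite mulmx2E !mxE /= ?(mulr1, mul1r, mulr0, mul0r, addr0).
apply: sphere_mul; last exact: sphere_e1.
by split; apply: mx2P; rewrite mulmx2E !adjE !mxE /= ?star0 ?star1
  ?(mulr1, mulr0, mul0r, addr0, add0r).
Qed.

Lemma hopf_right_mul x u : unitary u -> hopf (right_mul x u) = hopf x.
Proof.
move=> [_ us]; apply/matrixP => i j; rewrite !mulmx1E !adjE !mxE starMr.
by rewrite mulrA -(mulrA _ u) us mulr1.
Qed.

Lemma hopf_mul U x : hopf (U *m x) = conj_mx U (hopf x).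
Proof. by rewrite /hopf /conj_mx adjM !mulmxA. Qed.

(** The only candidate is [u = adj x *m y]; replacing [x x^*] by [y y^*] and back yields both
    unitarity relations and [x u = y]. *)
Lemma hopf_fiber x y : sphere x -> sphere y -> hopf x = hopf y ->
  exists2 u, unitary u & y = right_mul x u.
Proof.
move=> /sphere_norm nx /sphere_norm ny xy.
have uE : adj x *m y = ((adj x *m y) 0 0)%:M.
  by apply/matrixP => i j; rewrite !ord1 [RHS]mxE eqxx.
have adjy : adj y *m x = (star ((adj x *m y) 0 0))%:M.
  apply/matrixP => i j; rewrite !ord1 -[x in LHS]adjK -adjM adjE [RHS]mxE eqxx.
  by [].
have one (a b : A) : mulmx (a%:M : 'M[A]_1) (b%:M : 'M[A]_1) = 1%:M ->
    a * b = 1.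
  by move/matrixP/(_ 0 0); rewrite mulmx1E !mxE.
exists ((adj x *m y) 0 0).
  split; apply: one; rewrite -uE -adjy.
    by rewrite mulmxA -(mulmxA _ x) -/(hopf x) xy /hopf mulmxA ny mul1mx.
  by rewrite mulmxA -(mulmxA _ y) -/(hopf y) -xy /hopf mulmxA nx mul1mx.
by rewrite right_mulE -uE mulmxA -/(hopf x) xy /hopf -mulmxA ny mulmx1.
Qed.

Lemma p0E : p0 A = hopf (e1 A).
Proof.
by apply: mx2P; rewrite mulmx1E !adjE !mxE /= ?star0 ?star1 ?(mulr1, mulr0,
  mul0r).
Qed.

Lemma hopf_sphere : @hopf R A @` @sphere R A = @projections R A.
Proof.
apply/seteqP; split=> [_ [_ [U uU <-] <-]|_ [U uU <-]].
  by exists U => //; rewrite hopf_mul p0E.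
by exists (U *m e1 A); [exists U|rewrite hopf_mul p0E].
Qed.

Lemma mulmx_adjl U x : unitary_mx U -> adj U *m (U *m x) = x.
Proof. by move=> [uU _]; rewrite mulmxA uU mul1mx. Qed.

Lemma mulmx_adjr U x : unitary_mx U -> U *m (adj U *m x) = x.
Proof. by move=> [_ uU]; rewrite mulmxA uU mul1mx. Qed.

Lemma conj_mx_adjl U X : unitary_mx U -> conj_mx (adj U) (conj_mx U X) = X.
Proof.
by move=> [uU _]; rewrite /conj_mx adjK !mulmxA uU mul1mx -mulmxA uU mulmx1.
Qed.

Lemma conj_mx_adjr U X : unitary_mx U -> conj_mx U (conj_mx (adj U) X) = X.
Proof.
by move=> [_ uU]; rewrite /conj_mx adjK !mulmxA uU mul1mx -mulmxA uU mulmx1.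
Qed.

Lemma projections_conj U X : unitary_mx U -> projections X ->
  projections (conj_mx U X).
Proof.
rewrite -!hopf_sphere => uU [x sx <-]; exists (U *m x).
  exact: sphere_mul.
by rewrite hopf_mul.
Qed.

End TwoByTwo.

(** * Unit columns over an affine coordinate *)

Section LocalSection.
Context (R : realType) (A : cstarAlgType R).
Implicit Types (x y : 'cV[A]_2) (a b c u : A).

(** The inner product of the column [(1, a)] with itself; [local_section] normalizes that column by
    its inverse square root. *)
Definition gram a := 1 + star a * a.

Definition rho a := inverse (csqrt (gram a)).

Definition local_section a : 'cV[A]_2 := col2 (rho a) (a * rho a).

Lemma star_gram a : star (gram a) = gram a.
Proof. by rewrite starD star1 starMr starK. Qed.

(** The inverse is the square of the inverse of the self-adjoint root of [c]. *)
Lemma ppos_inverse c : star c = c -> ppos c -> ppos (inverse c).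
Proof.
move=> sc_ pc; pose d := csqrt c.
have id : invertible d by exact/ppos_invertible/ppos_csqrt.
have dd : d * d = c by exact: csqrtM.
have -> : inverse c = inverse d * inverse d.
  apply: is_inverseE; rewrite -dd; split.
    by rewrite mulrA -(mulrA d d) mulxV// mulr1 mulxV.
  by rewrite mulrA -(mulrA (inverse d) (inverse d)) mulVx// mulr1 mulVx.
apply: ppos_square; first by rewrite star_inverse// csqrt_star.
by exists d; split; [exact: mulVx|exact: mulxV].
Qed.

Section Positive.
Variables (a : A) (pa : ppos (gram a)).

Let ic : invertible (csqrt (gram a)).
Proof. exact/ppos_invertible/ppos_csqrt. Qed.

Let sc_ : star (csqrt (gram a)) = csqrt (gram a).
Proof. by apply: csqrt_star => //; exact: star_gram. Qed.

Lemma star_rho : star (rho a) = rho a.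
Proof. by rewrite /rho star_inverse// sc_. Qed.

Lemma ppos_rho : ppos (rho a).
Proof. by apply: ppos_inverse => //; exact: ppos_csqrt. Qed.

Lemma rho_invertible : invertible (rho a).
Proof. exact/ppos_invertible/ppos_rho. Qed.

Lemma rho_gram_rho : rho a * gram a * rho a = 1.
Proof.
rewrite -{1}(csqrtM pa) /rho mulrA mulVx// mul1r mulxV//.
Qed.

Lemma rho_square_gram : rho a * rho a * gram a = 1.
Proof.
by rewrite -(csqrtM pa) /rho -mulrA (mulrA (inverse _) (csqrt _)) mulVx// mul1r
  mulVx.
Qed.

Lemma gram_rho_square : gram a * (rho a * rho a) = 1.
Proof.
by rewrite -(csqrtM pa) /rho -mulrA (mulrA (csqrt _) (inverse _)) mulxV// mul1r
  mulxV.
Qed.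

End Positive.

(* [1 + a a^*] and [1 + a^* a] have the same resolvent on the negative axis. *)
Lemma ppos_gram_star a : ppos (gram a) -> ppos (gram (star a)).
Proof.
move=> pa; apply: ppos_of_resolvent; first exact: star_gram.
move=> t t0; rewrite /gram starK.
have -> : 1 + a * star a + sc A t = sc A (1 + t) - (- a) * star a by nc_ring.
apply: invertible_swap; first by rewrite gt_eqF// ltr_wpDr.
have -> : sc A (1 + t) - star a * - a = gram a + sc A t by rewrite /gram;
  nc_ring.
apply: ppos_invertible; apply: ppos_le t0 _.
by rewrite sc0 addr0.
Qed.

(** The sphere is an orbit of [e1], so the column has to be completed to a unitary matrix. The
    second column is the normalized [(- a^*, 1)], orthogonal to [(1, a)]. *)
Lemma sphere_local_section a : ppos (gram a) -> sphere (local_section a).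
Proof.
move=> pa; have pb := ppos_gram_star pa.
have sr := star_rho pa; have sk := star_rho pb.
set r := rho a in sr *; set k := rho (star a) in sk *.
have rgr : r * gram a * r = 1 by exact: rho_gram_rho.
have kgk : k * gram (star a) * k = 1 by exact: rho_gram_rho.
have rr1 : r * r * gram a = 1 by exact: rho_square_gram.
have kk2 : gram (star a) * (k * k) = 1 by exact: gram_rho_square.
have kk1 : k * k * gram (star a) = 1 by exact: rho_square_gram.
have rrk : r * r * star a = star a * (k * k).
  have ga : gram a * star a = star a * gram (star a).
    by rewrite /gram starK mulrDl mulrDr mulr1 mul1r mulrA.
  by rewrite -[LHS]mulr1 -kk2 !mulrA -(mulrA _ (star a)) -ga mulrA rr1 mul1r.
have arr : a * (r * r) = k * k * a.
  have := congr1 (@star R A) rrk.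
  by rewrite !starMr sr sk starK.
exists (mx22 r (- (star a * k)) (a * r) k); last first.
  by apply: cV2P; rewrite mulmx2E !mxE /= ?mulr1 ?mulr0 ?addr0.
split; apply: mx2P; rewrite mulmx2E !adjE !mxE /=
  ?starN ?starMr ?starK ?sr ?sk ?mulr1n ?mulr0n.
- by rewrite -[RHS]rgr /gram; nc_ring.
- by nc_ring.
- by nc_ring.
- by rewrite -[RHS]kgk /gram starK; nc_ring.
- rewrite (_ : _ + _ = r * r + star a * (k * k) * a); last by nc_ring.
  by rewrite -rrk -[RHS]rr1 /gram; nc_ring.
- rewrite (_ : _ + _ = r * r * star a - star a * (k * k)); last by nc_ring.
  by rewrite rrk subrr.
- rewrite (_ : _ + _ = a * (r * r) - k * k * a); last by nc_ring.
  by rewrite arr subrr.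
- rewrite (_ : _ + _ = a * (r * r) * star a + k * k); last by nc_ring.
  by rewrite arr -[RHS]kk1 /gram starK; nc_ring.
Qed.

(** [x^* x = 1] gives [gram a = y^* y] with [y = x_1^-1], so positivity comes from the invertible
    case. The unitary is [(gram a)^(1/2) x_1], which is isometric and invertible. *)
Lemma invertible_col_section x : sphere x -> invertible (x 0 0) ->
  ppos (gram (x 1 0 * inverse (x 0 0))) /\
  exists2 u, unitary u & x = right_mul (local_section (x 1 0 * inverse (x 0
    0))) u.
Proof.
move=> /sphere_normE; set x1 := x 0 0; set x2 := x 1 0; set y := inverse x1.
move=> nx ix; have x1y : x1 * y = 1 by exact: mulxV.
have yx1 : y * x1 = 1 by exact: mulVx.
have iy : invertible y by exists x1.
set a := x2 * y.
have ga : gram a = star y * star (star y).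
  rewrite starK -[star y]mulr1 -nx /gram starMr mulrDr mulrDl.
  by rewrite !mulrA -(starMr x1 y) x1y star1 mul1r x1y.
have pa : ppos (gram a).
  by rewrite ga; apply: ppos_mul_star; exact: invertible_star.
split=> //; pose c := csqrt (gram a).
have ic : invertible c by exact/ppos_invertible/ppos_csqrt.
have sc_ : star c = c by apply: csqrt_star => //; exact: star_gram.
have iu : invertible (c * x1) by exact: invertibleM.
have su : star (c * x1) * (c * x1) = 1.
  rewrite starMr sc_ mulrA -(mulrA _ c c) csqrtM// ga starK.
  by rewrite -!mulrA yx1 mulr1 -starMr yx1 star1.
exists (c * x1).
  split=> //; have -> : star (c * x1) = inverse (c * x1).
    by rewrite -[LHS]mulr1 -(mulxV iu) mulrA su mul1r.
  exact: mulxV.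
apply: cV2P; rewrite !mxE /= mulrA.
  by rewrite mulVx// mul1r.
by rewrite -(mulrA a) mulVx// mulr1 /a -mulrA yx1 mulr1.
Qed.

Lemma psi0_local_section a u : ppos (gram a) -> unitary u ->
  psi0 (right_mul (local_section a) u) = (a, u).
Proof.
move=> pa uu; rewrite /psi0 !mxE /=.
have ir := rho_invertible pa; have iu := unitary_invertible uu.
congr (_, _); last by apply: (polar_unitaryE uu (star_rho pa) (ppos_rho pa)).
by rewrite -(mulrA a) -mulrA mulxV ?mulr1//; exact: invertibleM.
Qed.

Lemma sphere0_section a u : ppos (gram a) -> unitary u ->
  sphere0 (right_mul (local_section a) u).
Proof.
move=> pa uu; split.
  by apply: sphere_right_mul => //; exact: sphere_local_section.
rewrite /= !mxE /=; apply: invertibleM; first exact: rho_invertible.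
exact: unitary_invertible.
Qed.

Lemma right_mul1 x : right_mul x 1 = x.
Proof. by rewrite right_mulE mulmx1. Qed.

Lemma hopf_inj_ratio x y : sphere0 x -> sphere0 y -> hopf x = hopf y ->
  x 1 0 * inverse (x 0 0) = y 1 0 * inverse (y 0 0).
Proof.
move=> [sx ix] [sy iy] xy; have [u uu ->] := hopf_fiber sx sy xy.
have iu := unitary_invertible uu.
rewrite !mxE (_ : inverse (x 0 0 * u) = inverse u * inverse (x 0 0)).
  by rewrite mulrA -(mulrA _ u) mulxV// mulr1.
apply: is_inverseE; split.
  by rewrite mulrA -(mulrA _ u) mulxV// mulr1 mulxV.
by rewrite mulrA -(mulrA (inverse u)) mulVx// mulr1 mulVx.
Qed.

Lemma phi0_hopf x : sphere0 x -> phi0 (hopf x) = x 1 0 * inverse (x 0 0).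
Proof.
move=> x0; rewrite /phi0.
set y := xget 0 _; have [y0 yx] : sphere0 y /\ hopf y = hopf x.
  by apply: (@xgetPex _ 0 [set z | sphere0 z /\ hopf z = hopf x]); exists x.
exact: hopf_inj_ratio.
Qed.

(* The corner [p_11] being invertible only makes [x_1] right invertible; its
   left invertibility is that of [1 - p_22]. *)
Lemma sphere0_hopf x : sphere x ->
  sphere0 x <-> invertible (hopf x 0 0) /\ invertible (1 - hopf x 1 1).
Proof.
move=> sx; have nx := sphere_normE sx; rewrite !mulmx1E !adjE.
have swap : invertible (1 - x 1 0 * star (x 1 0)) <->
            invertible (star (x 0 0) * x 0 0).
  have -> : star (x 0 0) * x 0 0 = 1 - star (x 1 0) * x 1 0 by rewrite -nx
    addrK.
  by rewrite -(sc1 A); split; apply: invertible_swap; rewrite oner_neq0.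
split=> [[_ ix]|[[y [h1 _]] /swap[z [_ h2]]]].
  by split; [|apply/swap]; apply: invertibleM => //; exact: invertible_star.
split=> //; apply: (@invertible_lr _ _ _ (star (x 0 0) * y) (z * star (x 0 0))).
  by rewrite mulrA.
by rewrite -mulrA.
Qed.

Lemma projections0P p : projections p ->
  (@projections0 R A p <-> invertible (p 0 0) /\ invertible (1 - p 1 1)).
Proof.
rewrite -hopf_sphere => -[x sx <-]; rewrite -sphere0_hopf//; split.
  move=> [y [sy iy] yx]; apply/sphere0_hopf => //.
  by rewrite -yx; apply/sphere0_hopf.
by exists x.
Qed.

(** The chosen preimage disappears because [x_1^*] cancels in [x_2 x_1^*] times the inverse of
    [x_1 x_1^*]; what remains is smooth in the entries of [p]. *)
Lemma phi0E p : @projections0 R A p -> phi0 p = p 1 0 * inverse (p 0 0).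
Proof.
move=> [x x0 <-]; rewrite phi0_hopf// !mulmx1E !adjE; have [_ ix] := x0.
have ix' := invertible_star ix.
rewrite (_ : inverse (_ * star _) = inverse (star (x 0 0)) * inverse (x 0 0)).
  by rewrite mulrA -(mulrA _ (star _)) mulxV// mulr1.
apply: is_inverseE; split.
  by rewrite mulrA -(mulrA _ (star _)) mulxV// mulr1 mulxV.
by rewrite mulrA -(mulrA _ (inverse (x 0 0))) mulVx// mulr1 mulVx.
Qed.

End LocalSection.

(** * Ambient formulas on products of the algebra *)

Section Ambient.
Context (R : realType) (A : cstarAlgType R).
Notation RA := (realify A).
Notation V2 := (RA * RA)%type.
Notation V4 := (V2 * V2)%type.
Implicit Types (E : normedModType R) (k : nat).

(** Columns and matrices enter the calculus as nested pairs, so that real smoothness is checked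
    entry by entry. *)
Definition iota2 (x : 'cV[A]_2) : V2 := (x 0 0, x 1 0).

Definition iota4 (p : 'M[A]_2) : V4 := ((p 0 0, p 0 1), (p 1 0, p 1 1)).

Lemma iota2_inj : injective iota2.
Proof. by move=> x y [h0 h1]; exact: cV2P. Qed.

Lemma iota4_inj : injective iota4.
Proof. by move=> x y [h00 h01 h10 h11]; exact: mx2P. Qed.

Definition act4 (P : V4) (x : V2) : V2 :=
  (rmul P.1.1 x.1 + rmul P.1.2 x.2, rmul P.2.1 x.1 + rmul P.2.2 x.2).

Definition mul4 (P Q : V4) : V4 :=
  ((rmul P.1.1 Q.1.1 + rmul P.1.2 Q.2.1, rmul P.1.1 Q.1.2 + rmul P.1.2 Q.2.2),
   (rmul P.2.1 Q.1.1 + rmul P.2.2 Q.2.1, rmul P.2.1 Q.1.2 + rmul P.2.2 Q.2.2)).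

Definition hopf4 (x : V2) : V4 :=
  ((rmul x.1 (rstar x.1), rmul x.1 (rstar x.2)),
   (rmul x.2 (rstar x.1), rmul x.2 (rstar x.2))).

Definition conj4 (X : 'M[A]_2) (P : V4) : V4 :=
  mul4 (mul4 (iota4 X) P) (iota4 (adj X)).

Definition section2 (a : RA) : V2 :=
  let r := rinv (rsqrt (((1 : A) : RA) + rmul (rstar a) a)) in (r, rmul a r).

(** The positivity of [x x^*] is established above for invertible [x], so the condition on [gram] is
    carried along as an open set. Coordinates of points of the spheres satisfy it by
    [invertible_col_section]. *)
Definition grams : set RA := [set a : RA | ppos (gram (a : A))].

Lemma act4E (X : 'M[A]_2) x : act4 (iota4 X) (iota2 x) = iota2 (X *m x).
Proof. by rewrite /iota2 !mulmx2E. Qed.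

Lemma mul4E (X Y : 'M[A]_2) : mul4 (iota4 X) (iota4 Y) = iota4 (X *m Y).
Proof. by rewrite /iota4 !mulmx2E. Qed.

Lemma conj4E X p : conj4 X (iota4 p) = iota4 (conj_mx X p).
Proof. by rewrite /conj4 !mul4E. Qed.

Lemma hopf4E x : hopf4 (iota2 x) = iota4 (hopf x).
Proof. by rewrite /iota4 !mulmx1E !adjE. Qed.

Lemma section2E (a : A) : section2 (a : RA) = iota2 (local_section a).
Proof. by rewrite /iota2 !mxE. Qed.

Section Smooth.
Context k E (U : set E) (oU : open U).

Lemma Ck_act4 (f : E -> V4) (g : E -> V2) : Ck k U f -> Ck k U g ->
  Ck k U (fun z => act4 (f z) (g z)).
Proof.
move=> Cf Cg.
have [Cf1 Cf2] := (Ck_fst oU Cf, Ck_snd oU Cf).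
have [Cf11 Cf12] := (Ck_fst oU Cf1, Ck_snd oU Cf1).
have [Cf21 Cf22] := (Ck_fst oU Cf2, Ck_snd oU Cf2).
have [Cg1 Cg2] := (Ck_fst oU Cg, Ck_snd oU Cg).
exact: (Ck_pair oU (CkD oU (CkM oU Cf11 Cg1) (CkM oU Cf12 Cg2))
  (CkD oU (CkM oU Cf21 Cg1) (CkM oU Cf22 Cg2))).
Qed.

Lemma Ck_mul4 (f g : E -> V4) : Ck k U f -> Ck k U g ->
  Ck k U (fun z => mul4 (f z) (g z)).
Proof.
move=> Cf Cg.
have [Cf1 Cf2] := (Ck_fst oU Cf, Ck_snd oU Cf).
have [Cf11 Cf12] := (Ck_fst oU Cf1, Ck_snd oU Cf1).
have [Cf21 Cf22] := (Ck_fst oU Cf2, Ck_snd oU Cf2).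
have [Cg1 Cg2] := (Ck_fst oU Cg, Ck_snd oU Cg).
have [Cg11 Cg12] := (Ck_fst oU Cg1, Ck_snd oU Cg1).
have [Cg21 Cg22] := (Ck_fst oU Cg2, Ck_snd oU Cg2).
apply: (Ck_pair oU); apply: (Ck_pair oU); apply: (CkD oU); exact: (CkM oU).
Qed.

Lemma Ck_hopf4 (f : E -> V2) : Ck k U f -> Ck k U (fun z => hopf4 (f z)).
Proof.
move=> Cf; have [Cf1 Cf2] := (Ck_fst oU Cf, Ck_snd oU Cf).
have [Cs1 Cs2] := (Ck_star oU Cf1, Ck_star oU Cf2).
apply: (Ck_pair oU); apply: (Ck_pair oU); exact: (CkM oU).
Qed.

Lemma Ck_conj4 X (f : E -> V4) : Ck k U f -> Ck k U (fun z => conj4 X (f z)).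
Proof.
by move=> Cf; apply: Ck_mul4; [apply: Ck_mul4 => //|]; exact: Ck_cst.
Qed.

Lemma Ck_gram (f : E -> RA) : Ck k U f ->
  Ck k U (fun z => ((1 : A) : RA) + rmul (rstar (f z)) (f z)).
Proof.
move=> Cf; apply: (CkD oU); first exact: Ck_cst.
by apply: (CkM oU) => //; exact: Ck_star.
Qed.

Lemma Ck_section2 (f : E -> RA) : Ck k U f -> (forall z, U z -> grams (f z)) ->
  Ck k U (fun z => section2 (f z)).
Proof.
move=> Cf fU.
have Cr : Ck k U (fun z => rinv (rsqrt (((1 : A) : RA) + rmul (rstar (f z)) (f
  z)))).
  apply: Ck_inv => //; first by apply: Ck_sqrt => //; exact: Ck_gram.
  by move=> z Uz; apply/ppos_invertible/ppos_csqrt/fU.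
by apply: (Ck_pair oU) => //; exact: CkM.
Qed.

End Smooth.

Lemma open_grams : open grams.
Proof.
have oT : open (setT : set RA) by exact: openT.
have -> : grams = setT `&`
    (fun a : RA => ((1 : A) : RA) + rmul (rstar a) a) @^-1` @pposs R A.
  by rewrite setTI.
apply: open_preimage_in => //; first exact: open_pposs.
move=> x _; apply: (@Ck_continuous _ 0 _ _ setT) => //.
by apply: Ck_gram => //; exact: Ck_id.
Qed.

End Ambient.

(** * Charts of the two spheres as restrictions of ambient maps *)

Section Charts.
Context (R : realType) (A : cstarAlgType R).
Notation RA := (realify A).
Notation V2 := (RA * RA)%type.
Notation V4 := (V2 * V2)%type.

Lemma embedded_unitary_sphere : embedded (unitary_sphere A) (@iota2 R A).
Proof.
have eN := embedded_prod (@embedded_alg_manifold R A) (@embedded_unitary_group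
  R A).
have oT2 : open (setT : set V2) by exact: openT.
apply: (embedded_charted (@iota2_inj R A) eN).
  move=> _ [U uU <-]; exists ((mulmx U) @` @sphere0 R A, @psi0 R A \o mulmx
    (adj U)).
    by exists U.
  exists (e1 A) => //; split; first exact: sphere_e1.
  by rewrite /= mxE; exists 1; rewrite /is_inverse mulr1.
move=> _ [U uU <-] /=.
have uU' := unitary_mx_adj uU.
pose eta (x : V2) : V2 := act4 (iota4 (adj U)) x.
pose W : set V2 := [set x | units (eta x).1].
(* The second component is the polar unitary in closed form; by [ppos_mul_star] it is smooth
   wherever the first entry is invertible, also off the sphere. *)
pose P (x : V2) : V2 := (rmul (eta x).2 (rinv (eta x).1),
  rmul (rinv (rsqrt (rmul (eta x).1 (rstar (eta x).1)))) (eta x).1).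
pose Om : set V2 := [set q | grams q.1].
pose sg (q : V2) : V2 := act4 (iota4 U)
  (rmul (section2 q.1).1 q.2, rmul (section2 q.1).2 q.2).
have Ceta k (X : set V2) : open X -> Ck k X eta.
  by move=> oX; apply: Ck_act4 => //; [exact: Ck_cst|exact: Ck_id].
have oW : open W.
  have -> : W = setT `&` (fun x => (eta x).1) @^-1` @units R A by rewrite setTI.
  apply: open_preimage_in; [exact: oT2|exact: open_units|move=> x _].
  apply: (@Ck_continuous _ 0 _ _ setT) => //.
  by apply: (Ck_fst oT2); exact: Ceta.
have oOm : open Om.
  have -> : Om = setT `&` (fun q : V2 => q.1) @^-1` @grams R A by rewrite setTI.
  apply: open_preimage_in; [exact: oT2|exact: open_grams|move=> x _].
  exact: cvg_fst.
have sgE (a u : A) : sg (a, u) = iota2 (U *m right_mul (local_section a) u).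
  by rewrite -act4E /sg section2E /iota2 [(right_mul _ _) 0 0]mxE
    [(right_mul _ _) 1 0]mxE.
have etaE x : eta (iota2 x) = iota2 (adj U *m x) by exact: act4E.
have WE x : W (iota2 x) = invertible ((adj U *m x) 0 0).
  by rewrite /W /mkset etaE.
exists W, P, Om, sg; split; first by split.
- move=> k; split.
    have C1 := Ck_fst oW (Ceta k W oW); have C2 := Ck_snd oW (Ceta k W oW).
    apply: (Ck_pair oW); first by apply: CkM => //; exact: Ck_inv.
    apply: CkM => //; apply: Ck_inv => //.
      apply: Ck_sqrt => //; first by apply: CkM => //; exact: Ck_star.
      by move=> x Wx; exact: ppos_mul_star.
    by move=> x Wx; apply/ppos_invertible/ppos_csqrt/ppos_mul_star.
  have Cid := Ck_id k oOm; have C2 := Ck_snd oOm Cid.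
  have Cs : Ck k Om (fun q => section2 q.1).
    by apply: Ck_section2 => //; exact: Ck_fst.
  apply: Ck_act4 => //; first exact: Ck_cst.
  apply: (Ck_pair oOm); apply: CkM => //; [exact: Ck_fst|exact: Ck_snd].
- move=> x; rewrite WE; split=> [[y [sy iy] <-]|[sx ix]].
    by rewrite mulmx_adjl//; split=> //; exact: sphere_mul.
  exists (adj U *m x); last exact: mulmx_adjr.
  by split=> //; exact: sphere_mul.
- move=> _ [x [sx ix] <-].
  have [pa [u uu xE]] := invertible_col_section sx ix.
  have psiE : psi0 x = (x 1 0 * inverse (x 0 0), u).
    by rewrite {1}xE psi0_local_section.
  have -> : (@psi0 R A \o mulmx (adj U)) (U *m x) = (x 1 0 * inverse (x 0 0),
    u).
    by rewrite /comp mulmx_adjl.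
  have uE : polar_unitary (x 0 0) = u by move: psiE; rewrite /psi0 => -[].
  split=> //.
  + by rewrite /P etaE mulmx_adjl// -uE (polar_unitary_inverse ix).
  + by rewrite sgE -xE.
- move=> [a u] [/= _ uu] ga.
  exists (U *m right_mul (local_section a) u).
    by exists (right_mul (local_section a) u) => //; exact: sphere0_section.
  by rewrite mulmx_adjl// psi0_local_section.
Qed.

Section RiemannChart.
Variables (U : 'M[A]_2) (uU : unitary_mx U).

Definition ratio4 (P : V4) : RA :=
  rmul (conj4 (adj U) P).2.1 (rinv (conj4 (adj U) P).1.1).

Definition ratio4_dom : set V4 :=
  [set P | units (conj4 (adj U) P).1.1 /\
           units (((1 : A) : RA) - (conj4 (adj U) P).2.2)].

Lemma open_ratio4_dom : open ratio4_dom.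
Proof.
have oT4 : open (setT : set V4) by exact: openT.
have Cc k : Ck k setT (conj4 (adj U)) by apply: Ck_conj4 => //; exact: Ck_id.
have -> : ratio4_dom =
  (setT `&` (fun P => (conj4 (adj U) P).1.1) @^-1` @units R A) `&`
  (fun P => ((1 : A) : RA) - (conj4 (adj U) P).2.2) @^-1` @units R A.
  by rewrite setTI.
have o1 : open (setT `&` (fun P => (conj4 (adj U) P).1.1) @^-1` @units R A).
  apply: open_preimage_in; [exact: oT4|exact: open_units|move=> x _].
  apply: (@Ck_continuous _ 0 _ _ setT) => //.
  exact: (Ck_fst oT4 (Ck_fst oT4 (Cc 0))).
apply: open_preimage_in; [exact: o1|exact: open_units|move=> x _].
apply: (@Ck_continuous _ 0 _ _ setT) => //.
by apply: (CkB oT4); [exact: Ck_cst|exact: (Ck_snd oT4 (Ck_snd oT4 (Cc 0)))].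
Qed.

Lemma Ck_ratio4 k : Ck k ratio4_dom ratio4.
Proof.
have oW := open_ratio4_dom.
have Cc : Ck k ratio4_dom (conj4 (adj U)) by apply: Ck_conj4 => //;
  exact: Ck_id.
have [C1 C2] := (Ck_fst oW Cc, Ck_snd oW Cc).
apply: CkM => //; first exact: Ck_fst.
by apply: Ck_inv => //; [exact: Ck_fst|move=> P []].
Qed.

Lemma ratio4_domP p : (conj_mx U @` @projections0 R A) p <->
  projections p /\ ratio4_dom (iota4 p).
Proof.
have uU' := unitary_mx_adj uU.
rewrite /ratio4_dom /mkset conj4E; split=> [[q q0 <-]|[pp Wp]].
  have [x [sx ix] xq] := q0.
  have qp : projections q by rewrite -hopf_sphere; exists x.
  rewrite conj_mx_adjl//; split; first exact: projections_conj.
  exact/projections0P.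
exists (conj_mx (adj U) p); last exact: conj_mx_adjr.
by apply/projections0P => //; exact: projections_conj.
Qed.

Lemma ratio4_phi0 p : (conj_mx U @` @projections0 R A) p ->
  ratio4 (iota4 p) = phi0 (conj_mx (adj U) p).
Proof.
by move=> [q q0 <-]; rewrite /ratio4 conj4E conj_mx_adjl// phi0E.
Qed.

Lemma gram_phi0 p : (conj_mx U @` @projections0 R A) p ->
  let a := phi0 (conj_mx (adj U) p) in
  ppos (gram a) /\ hopf (U *m local_section a) = p.
Proof.
move=> [_ [x [sx ix] <-] <-] /=; rewrite conj_mx_adjl// phi0_hopf//.
have [pa [u uu xE]] := invertible_col_section sx ix; split=> //.
by rewrite hopf_mul {3}xE hopf_right_mul.
Qed.

End RiemannChart.

Lemma projections_cover p : projections p ->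
  exists2 U, unitary_mx U & (conj_mx U @` @projections0 R A) p.
Proof.
move=> [U uU <-]; exists U => //; exists (p0 A) => //.
rewrite p0E; exists (e1 A) => //; split; first exact: sphere_e1.
by rewrite /= mxE; exists 1; rewrite /is_inverse mulr1.
Qed.

Lemma embedded_riemann_sphere : embedded (riemann_sphere A) (@iota4 R A).
Proof.
apply: (embedded_charted (@iota4_inj R A) (@embedded_alg_manifold R A)).
  move=> p /projections_cover[U uU pU].
  by exists (conj_mx U @` @projections0 R A, @phi0 R A \o conj_mx (adj U)) =>
    //;
    exists U.
move=> _ [U uU <-] /=.
exists (ratio4_dom U), (ratio4 U), (@grams R A),
  (fun a => conj4 U (hopf4 (section2 a))).
have sgE (a : A) :
    conj4 U (hopf4 (section2 (a : RA))) = iota4 (hopf (U *m local_section a)).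
  by rewrite section2E hopf4E conj4E hopf_mul.
split.
- by split; [exact: open_ratio4_dom|exact: open_grams].
- move=> k; split; first exact: Ck_ratio4.
  have oG := @open_grams R A.
  by apply: Ck_conj4 => //; apply: Ck_hopf4 => //; apply: Ck_section2 => //;
    exact: Ck_id.
- exact: ratio4_domP.
- move=> p Dp; have [pa pE] := gram_phi0 uU Dp.
  by split=> //; [exact: ratio4_phi0|rewrite sgE pE].
- move=> a _ ga; exists (hopf (U *m local_section a)).
    exists (hopf (local_section a)); last by rewrite hopf_mul.
    exists (local_section a) => //; rewrite -[local_section a]right_mul1.
    by apply: sphere0_section => //; exact: unitary1.
  rewrite /= hopf_mul conj_mx_adjl// -[local_section a]right_mul1.
  have := sphere0_section ga (unitary1 A) => x0.
  by rewrite phi0_hopf//; have [] := psi0_local_section ga (unitary1 A).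
Qed.

End Charts.

(** * The Hopf bundle *)

Lemma right_mul_free_smooth_action (R : realType) (A : cstarAlgType R) :
  is_free_smooth_right_action (unitary_group A) *%R 1
    (unitary_sphere A) (@right_mul R A).
Proof.
have eU := @embedded_unitary_group R A; have eS := @embedded_unitary_sphere R A.
have oT : open (setT : set ((realify A * realify A) * realify A)%type).
  exact: openT.
split.
- apply: (@embedded_smooth_map _ _ _ _ _ _ _ _ _ _ _ (embedded_prod eS eU) eS
    (points (unitary_sphere A) `*` points (unitary_group A)) setT
    (fun p => (rmul p.1.1 p.2, rmul p.1.2 p.2))) => //.
  + move=> k; have Cid := Ck_id k oT.
    have [C1 C2] := (Ck_fst oT Cid, Ck_snd oT Cid).
    exact: (Ck_pair oT (CkM oT (Ck_fst oT C1) C2) (CkM oT (Ck_snd oT C1) C2)).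
  + by move=> p; split=> // -[].
  + move=> [x u] [/= sx uu]; split; first exact: sphere_right_mul.
    by rewrite /iota2 !mxE.
- by move=> x _; exact: right_mul1.
- by move=> x u v _ _ _; apply/colP => i; rewrite !mxE mulrA.
(* Multiplying [x u = x] on the left by [adj x] leaves [u = 1]. *)
- move=> x u /sphere_norm nx _ xu.
  have : adj x *m right_mul x u = 1%:M by rewrite xu.
  by rewrite right_mulE mulmxA nx mul1mx => /matrixP/(_ 0 0); rewrite !mxE.
Qed.

Lemma hopf_smooth_local_section (R : realType) (A : cstarAlgType R) (b :
  'M[A]_2) :
  points (riemann_sphere A) b ->
  exists W (s : 'M[A]_2 -> 'cV[A]_2),
    [/\ open_in (riemann_sphere A) W, W b,
        smooth_map (riemann_sphere A) (unitary_sphere A) W s &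
        forall p, W p -> hopf (s p) = p].
Proof.
move=> /projections_cover[U uU bU].
have eB := @embedded_riemann_sphere R A; have eS := @embedded_unitary_sphere R
  A.
have oW := @open_ratio4_dom R A U.
exists (conj_mx U @` @projections0 R A),
  (fun p => U *m local_section (phi0 (conj_mx (adj U) p))); split=> //.
- exact: (embedded_open_in eB oW (ratio4_domP uU)).
(* The ambient formula for the section also needs the ratio to lie in [grams]. By [gram_phi0] this
   smaller open set contains the same projections, so the section lives on the whole chart
   domain. *)
- have oW' : open (ratio4_dom U `&` ratio4 U @^-1` @grams R A).
    apply: open_preimage_in; [exact: oW|exact: open_grams|move=> P].
    exact: (Ck_continuous (Ck_ratio4 U 0)).
  apply: (@embedded_smooth_map _ _ _ _ _ _ _ _ _ _ _ eB eS _ _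
    (fun P => act4 (iota4 U) (section2 (ratio4 U P))) _ oW').
  + move=> k; apply: (Ck_act4 oW'); first exact: Ck_cst.
    apply: (Ck_section2 oW'); last by move=> P [].
    by apply: Ck_sub (Ck_ratio4 U k) => P [].
  + move=> p; split=> [Dp|[pp [Wp _]]]; last exact/ratio4_domP.
    have [pp Wp] := (ratio4_domP uU p).1 Dp; split=> //; split=> //.
    by rewrite /preimage /mkset (ratio4_phi0 uU Dp); have [] := gram_phi0 uU Dp.
  + move=> p Dp; have [pa _] := gram_phi0 uU Dp; split.
      by apply: sphere_mul => //; exact: sphere_local_section.
    by rewrite (ratio4_phi0 uU Dp) section2E act4E.
- by move=> p Dp; have [] := gram_phi0 uU Dp.
Qed.

Theorem theorem4p1 (R : realType) (A : cstarAlgType R) :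
  is_smooth_principal_bundle (unitary_group A) *%R 1 star
    (unitary_sphere A) (riemann_sphere A) (@right_mul R A) (@hopf R A).
Proof.
have eB := @embedded_riemann_sphere R A; have eS := @embedded_unitary_sphere R
  A.
have oT : open (setT : set (realify A * realify A)%type) by exact: openT.
split.
- by split; [exact: embedded_is_manifold eS|exact: embedded_is_manifold eB].
- by split; [exact: unitary_group_lie|exact: right_mul_free_smooth_action].
- split; last exact: hopf_sphere.
  apply: (@embedded_smooth_map _ _ _ _ _ _ _ _ _ _ _ eS eB
    (points (unitary_sphere A)) setT (@hopf4 R A)) => //.
  + by move=> k; apply: (Ck_hopf4 oT); exact: Ck_id.
  + by move=> p; split=> // -[].
  + move=> x sx; split; last exact: hopf4E.
    by rewrite /= -hopf_sphere; exists x.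
- move=> x y sx sy; split=> [|[u uu ->]]; first exact: hopf_fiber.
  by rewrite hopf_right_mul.
- exact: hopf_smooth_local_section.
Qed.
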